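(* Let $A$ be a finite dimensional Hopf algebra over a field $k$, let $H=D(A)$ be its Drinfel'd double with its canonical $R$-matrix $R$, and let $\mathcal{H}(A)=A\#A^*$ be its Heisenberg double. Then, identifying $D(A)^*$ with $A\otimes A^*$ as vector spaces, $H^*_R=\mathcal{H}(A)$ as algebras. Consequently $\mathcal{H}(A)$ (with the left and right regular actions of $D(A)$ on $D(A)^*$) is an algebra in the tensor categories $D(A)_l$, $D(A)_r$ and $D(A)_{lr}$, and it is quantum commutative as an algebra in the braided tensor category $D(A)_{lr}$.
   Context: For a Hopf algebra $A$ with antipode $S$, $\Delta(a)=\sum a_1\otimes a_2$. On the finite dimensional dual $A^*$: the product is convolution $(pq)(a)=\sum p(a_1)q(a_2)$, and $\Delta(p)=\sum p_1\otimes p_2$ with $p(ab)=\sum p_1(a)p_2(b)$. Regular actions of an algebra $H$ on $H^*$: $(h\rightharpoonup p)(h')=p(h'h)$, $(p\leftharpoonup h)(h')=p(hh')$. Drinfel'd double $D(A)$: the vector space $A^*\otimes A$ with the tensor coalgebra structure of $A^{*cop}\otimes A$, i.e. $\Delta(p\otimes a)=\sum(p_2\otimes a_1)\otimes(p_1\otimes a_2)$, multiplication $(p\otimes a)(p'\otimes a')=\sum p(a_1\rightharpoonup p'\leftharpoonup S^{-1}(a_3))\otimes a_2a'$, and $R$-matrix $R=\sum_i(\varepsilon\otimes e_i)\otimes(e^i\otimes 1)$, where $\{e_i\}$ is a basis of $A$ with dual basis $\{e^i\}$ of $A^*$. The identification $D(A)^*\cong A\otimes A^*$ is $(a\otimes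 f)(p\otimes x)=p(a)f(x)$. Heisenberg double $\mathcal{H}(A)$: the vector space $A\otimes A^*$ with product $(a\otimes p)(a'\otimes p')=\sum a(p_1\rightharpoonup a')\otimes p_2p'$, where $p\rightharpoonup a=\sum p(a_2)a_1$. For a quasitriangular bialgebra $(H,R)$, $R=\sum R^1\otimes R^2$: $H^*_R$ is $H^*$ with product $f\cdot g=\sum(R^2\rightharpoonup g)(R^1\rightharpoonup f)$ (convolution on the right), i.e. $(f\cdot g)(h)=\sum g(h_1R^2)f(h_2R^1)$. $H_l$, $H_r$, $H_{lr}$ are the categories of left $H$-modules, right $H$-modules and $H$-bimodules, with the trivial associativity constraints and tensor products $h\cdot(v\otimes w)=\sum h_1\cdot v\otimes h_2\cdot w$; $(v\otimes w)\cdot h=\sum v\cdot h_2\otimes w\cdot h_1$; and $h\cdot(v\otimes w)\cdot h'=\sum h_1\cdot v\cdot h_2'\otimes h_2\cdot w\cdot h_1'$ respectively. The braiding on $H_{lr}$ is $c_{V,W}(v\otimes w)=\sum R^2\cdot w\cdot U^1\otimes R^1\cdot v\cdot U^2$, where $U=\sum U^1\otimes U^2=R^{-1}$. An algebra $B$ with multiplication $m_B$ in a braided tensor category with braiding $c$ is quantum commutative if $m_B\circ c_{B,B}=m_B$. *)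

(* Defs.v *)
From HB Require Import structures.
From mathcomp Require Import all_boot all_order all_algebra all_field.

Set Implicit Arguments.
Unset Strict Implicit.
Unset Printing Implicit Defensive.

Import GRing.Theory.
Local Open Scope ring_scope.

Declare Scope tensor_scope.
Local Open Scope tensor_scope.

Notation dual V := 'Hom(V%type, _^o).

(* V ⊗ W is realised as Hom(V^*, W), with v ⊗ w the map p |-> p(v) w.        *)
(* This is the usual canonical isomorphism, as all spaces here are finite     *)
(* dimensional; the universal property is tsumE / tsum_uniq below.            *)

Definition tensor (k : fieldType) (V W : vectType k) : vectType k :=
  'Hom(dual V, W).
Arguments tensor {k} (V W)%_type_scope.
Notation "V ⊗ W" := (tensor V W) (at level 40, left associativity) : type_scope.

Definition tens (k : fieldType) (V W : vectType k) (v : V) (w : W) : V ⊗ W :=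
  linfun (fun p : dual V => (p v : k) *: w).
Notation "v ⊗ w" := (tens v w) (at level 40, left associativity)
  : tensor_scope.

Definition vbas (k : fieldType) (V : vectType k) (i : 'I_(\dim {:V})) : V :=
  (vbasis {:V})`_i.
Definition dbas (k : fieldType) (V : vectType k) (i : 'I_(\dim {:V})) : dual V :=
  linfun (coord (vbasis {:V}) i : V -> k^o).

(* The linear map V ⊗ W -> U induced by a bilinear map f : V -> W -> U.       *)
Definition tsum (k : fieldType) (V W U : vectType k) (t : V ⊗ W)
    (f : V -> W -> U) : U :=
  \sum_i f (vbas i) ((t : 'Hom(dual V, W)) (dbas i)).
Arguments tsum {k V W U} t f.

(* Sweedler notation: \sw_(x, y <- t) F is "the sum of F x y" over any        *)
(* expression t = sum of x ⊗ y; F has to be bilinear in x and y.              *)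
Notation "\sw_ ( x , y <- t ) F" := (tsum t (fun x y => F))
  (at level 41, x name, y name, t at level 60, F at level 41,
   format "\sw_ ( x ,  y  <-  t )  F").

Definition bilinear (k : fieldType) (V W U : vectType k) (f : V -> W -> U) :=
  (forall v, linear (f v)) /\ (forall w, linear (f^~ w)).

Section TensorFacts.
Variables (k : fieldType) (V W U : vectType k).

Lemma linfunE (X Y : vectType k) (f : X -> Y) : linear f -> linfun f =1 f.
Proof.
move=> lin_f x; pose m := GRing.isLinear.Build _ _ _ _ f lin_f.
pose F : {linear X -> Y} := HB.pack f m.
by rewrite -[f]/(F : _ -> _) lfunE.
Qed.

Lemma tensE (v : V) (w : W) (p : dual V) :
  (v ⊗ w : 'Hom(dual V, W)) p = (p v : k) *: w.
Proof.
rewrite linfunE // => a q r.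
by rewrite add_lfunE scale_lfunE scalerDl scalerA.
Qed.

Lemma dbas_sum (v : V) : v = \sum_i (dbas i v : k) *: vbas i.
Proof.
rewrite [LHS](coord_vbasis (memvf v)); apply: eq_bigr => i _.
by rewrite /dbas lfunE.
Qed.

Lemma dual_sum (p : dual V) : p = \sum_i (p (vbas i) : k) *: dbas i.
Proof.
apply/lfunP => v; rewrite {1}[v]dbas_sum linear_sum sum_lfunE.
by apply: eq_bigr => i _; rewrite linearZ scale_lfunE /GRing.scale /= mulrC.
Qed.

Lemma tens_bilinear : bilinear (@tens k V W).
Proof.
split=> [v a w w' | w a v v']; apply/lfunP => p.
  rewrite add_lfunE scale_lfunE !tensE scalerDr !scalerA.
  by rewrite [_ * a]mulrC.
rewrite add_lfunE scale_lfunE !tensE linearP scalerDl scalerA.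
by [].
Qed.

Lemma tsumE (f : V -> W -> U) v w :
  bilinear f -> tsum (v ⊗ w) f = f v w.
Proof.
case=> lr ll; rewrite /tsum.
under eq_bigr do rewrite tensE -[f _ _]/(f _ (_ *: _)).
rewrite {2}[v]dbas_sum.
pose F : {linear V -> U} :=
  HB.pack (f^~ w) (GRing.isLinear.Build _ _ _ _ (f^~ w) (ll w)).
rewrite -[RHS]/(F _) linear_sum; apply: eq_bigr => i _.
pose G : {linear W -> U} :=
  HB.pack (f (vbas i)) (GRing.isLinear.Build _ _ _ _ _ (lr (vbas i))).
by rewrite -[LHS]/(G _) !linearZ.
Qed.

Lemma tsum_linear (f : V -> W -> U) : bilinear f -> linear (fun t : V ⊗ W => tsum t f).
Proof.
case=> lr _ a s t; rewrite /tsum scaler_sumr -big_split /=.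
by apply: eq_bigr => i _; rewrite add_lfunE scale_lfunE lr.
Qed.

Lemma tensor_span (t : V ⊗ W) :
  t = \sum_i vbas i ⊗ (t : 'Hom(dual V, W)) (dbas i).
Proof.
apply/lfunP => p; rewrite sum_lfunE {1}[p]dual_sum linear_sum.
by apply: eq_bigr => i _; rewrite tensE linearZ.
Qed.

Lemma tsum_uniq (f : V -> W -> U) (g : V ⊗ W -> U) : linear g ->
  (forall v w, g (v ⊗ w) = f v w) -> g =1 (fun t => tsum t f).
Proof.
move=> lin_g gE t; rewrite {1}[t]tensor_span.
pose G : {linear tensor V W -> U} :=
  HB.pack g (GRing.isLinear.Build _ _ _ _ _ lin_g).
rewrite -[LHS]/(G _) linear_sum; apply: eq_bigr => i _; exact: gE.
Qed.

End TensorFacts.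

(* Algebras and bialgebras as raw data: the axioms are separate predicates,   *)
(* since for D(A), H^*_R and the Heisenberg double they are theorems.         *)

Record algData (k : fieldType) := AlgData {
  alg_sort :> vectType k;
  amul : alg_sort -> alg_sort -> alg_sort;
  aone : alg_sort }.

Definition is_algebra (k : fieldType) (B : algData k) :=
  [/\ bilinear (@amul k B),
      forall x y z : B, amul x (amul y z) = amul (amul x y) z
    & forall x : B, amul (aone B) x = x /\ amul x (aone B) = x].

Definition algebra_iso (k : fieldType) (B C : algData k) (f : B -> C) :=
  [/\ linear f, bijective f,
      forall x y, f (amul x y) = amul (f x) (f y)
    & f (aone B) = aone C].

Record bialgData (k : fieldType) := BialgData {
  bialg_alg :> algData k;
  bcomul : bialg_alg -> bialg_alg ⊗ bialg_alg;
  bcounit : dual bialg_alg }.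

Definition coassociative (k : fieldType) (C : vectType k) (D : C -> C ⊗ C) :=
  forall c, \sw_(c1, c2 <- D c) \sw_(c11, c12 <- D c1) c11 ⊗ (c12 ⊗ c2)
          = \sw_(c1, c2 <- D c) c1 ⊗ D c2.

Definition counital (k : fieldType) (C : vectType k) (D : C -> C ⊗ C)
    (eps : dual C) :=
  forall c, \sw_(c1, c2 <- D c) (eps c1 : k) *: c2 = c
         /\ \sw_(c1, c2 <- D c) (eps c2 : k) *: c1 = c.

Definition tmult (k : fieldType) (B : algData k) (t : B ⊗ B) : B :=
  \sw_(x, y <- t) amul x y.

Definition tmul (k : fieldType) (B : algData k) (s t : B ⊗ B) : B ⊗ B :=
  \sw_(x, y <- s) \sw_(x', y' <- t) amul x x' ⊗ amul y y'.

Definition is_bialgebra (k : fieldType) (H : bialgData k) :=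
  [/\ is_algebra H,
      [/\ linear (@bcomul k H), coassociative (@bcomul k H)
        & counital (@bcomul k H) (bcounit H)],
      (forall x y : H, bcomul (amul x y) = tmul (bcomul x) (bcomul y))
      /\ bcomul (aone H) = aone H ⊗ aone H
    & (forall x y : H, bcounit H (amul x y) = bcounit H x * bcounit H y)
      /\ bcounit H (aone H) = 1].

HB.mixin Record Falgebra_isHopf (k : fieldType) A of Falgebra k A := {
  comul : 'Hom(A, (A ⊗ A)%type);
  counit : dual A;
  antipode : 'End(A);
  hopf_bialgebra :
    is_bialgebra (BialgData (bialg_alg := AlgData *%R 1) comul counit);
  antipode_axiom : forall a : A,
       \sw_(a1, a2 <- comul a) antipode a1 * a2 = (counit a : k)%:A
    /\ \sw_(a1, a2 <- comul a) a1 * antipode a2 = (counit a : k)%:A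
}.

#[short(type="hopfAlgType")]
HB.structure Definition HopfAlgebra (k : fieldType) :=
  { A of Falgebra_isHopf k A & Falgebra k A }.

Definition conv (k : fieldType) (C : vectType k) (D : C -> C ⊗ C)
    (p q : dual C) : dual C :=
  linfun (fun c => \sw_(c1, c2 <- D c) (p c1 * q c2 : k^o)).

(* Regular actions of B on B^*: (h ⇀ p)(x) = p(xh) and (p ↼ h)(x) = p(hx).    *)
Definition lreg (k : fieldType) (B : algData k) (h : B) (p : dual B) : dual B :=
  linfun (fun x => p (amul x h)).
Definition rreg (k : fieldType) (B : algData k) (p : dual B) (h : B) : dual B :=
  linfun (fun x => p (amul h x)).

Definition alg_of (k : fieldType) (A : falgType k) : algData k :=
  AlgData (@GRing.mul A) 1.

Definition conjg_reg (k : fieldType) (A : falgType k) (a : A) (p : dual A)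
  (b : A) : dual A := @rreg k (alg_of A) (@lreg k (alg_of A) a p) b.

Section Doubles.
Variables (k : fieldType) (A : hopfAlgType k).

(* The coproduct of A^*: the element of A^* ⊗ A^* characterised by            *)
(* p(ab) = sum of p1(a) p2(b), see dual_comulE.                               *)
Definition dual_comul (p : dual A) : dual A ⊗ dual A :=
  \sum_i \sum_j (p (vbas i * vbas j) : k) *: (dbas i ⊗ dbas j).

Definition dual_conv : dual A -> dual A -> dual A := conv (@comul k A).

(* (p ⊗ a)(p' ⊗ a') = sum of p (a1 ⇀ p' ↼ S^-1(a3)) ⊗ a2 a'.                  *)
(* The antipode of a finite dimensional Hopf algebra is bijective, and        *)
(* (antipode^-1)%VF is then its inverse.                                      *)
Definition dd_mul (u v : dual A ⊗ A) : dual A ⊗ A :=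
  \sw_(p, a <- u) \sw_(p', a' <- v)
    \sw_(a1, a23 <- comul a) \sw_(a2, a3 <- comul a23)
      dual_conv p (conjg_reg a1 p' ((antipode^-1)%VF a3)) ⊗ (a2 * a').

(* Coalgebra structure of A^{*cop} ⊗ A. *)
Definition dd_comul (u : dual A ⊗ A) : (dual A ⊗ A) ⊗ (dual A ⊗ A) :=
  \sw_(p, a <- u) \sw_(p1, p2 <- dual_comul p) \sw_(a1, a2 <- comul a)
    (p2 ⊗ a1) ⊗ (p1 ⊗ a2).

Definition dd_counit : dual (dual A ⊗ A) :=
  linfun (fun u : dual A ⊗ A => \sw_(p, a <- u) (p 1 * counit a : k^o)).

Definition drinfeld_double : bialgData k :=
  @BialgData k (AlgData dd_mul (counit ⊗ 1)) dd_comul dd_counit.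

Definition dd_R : drinfeld_double ⊗ drinfeld_double :=
  \sum_i ((counit : dual A) ⊗ vbas i) ⊗ (dbas i ⊗ (1 : A)).

(* p ⇀ a = sum of p(a2) a1. *)
Definition dual_act (p : dual A) (a : A) : A :=
  \sw_(a1, a2 <- comul a) (p a2 : k) *: a1.

(* (a # p)(a' # p') = sum of a (p1 ⇀ a') # p2 p'. *)
Definition heis_mul (u v : A ⊗ dual A) : A ⊗ dual A :=
  \sw_(a, p <- u) \sw_(a', p' <- v) \sw_(p1, p2 <- dual_comul p)
    (a * dual_act p1 a') ⊗ dual_conv p2 p'.

Definition heisenberg_double : algData k := AlgData heis_mul (1 ⊗ counit).

(* The identification A ⊗ A^* -> D(A)^*, (a ⊗ f)(p ⊗ x) = p(a) f(x).          *)
Definition dd_ident : 'Hom(heisenberg_double, dual drinfeld_double) :=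
  linfun (fun w : A ⊗ dual A => linfun (fun u : dual A ⊗ A =>
    \sw_(a, f <- w) \sw_(p, x <- u) (p a * f x : k^o))).

(* The regular actions of D(A) on D(A)^*, transported to A ⊗ A^*. *)
Definition heis_lact (h : drinfeld_double) (b : heisenberg_double)
    : heisenberg_double := (dd_ident^-1)%VF (lreg h (dd_ident b)).
Definition heis_ract (b : heisenberg_double) (h : drinfeld_double)
    : heisenberg_double := (dd_ident^-1)%VF (rreg (dd_ident b) h).

Lemma dual_comulE (p : dual A) (a b : A) :
  p (a * b) = \sw_(p1, p2 <- dual_comul p) (p1 a * p2 b : k^o).
Proof.
have bil: bilinear (fun p1 p2 : dual A => (p1 a * p2 b : k^o)).
  split=> [q c r s | q c r s]; rewrite /= add_lfunE scale_lfunE.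
    by rewrite mulrDr mulrCA.
  by rewrite mulrDl -mulrA.
rewrite -(linfunE (tsum_linear bil)) {1}[a]dbas_sum mulr_suml !linear_sum.
apply: eq_bigr => i _; rewrite {1}[b]dbas_sum mulr_sumr !linear_sum.
apply: eq_bigr => j _; rewrite linearZ /= (linfunE (tsum_linear bil)) tsumE //.
rewrite -scalerAl -scalerAr !linearZ /=.
by congr (_ *: _); apply: mulrC.
Qed.

Lemma dd_identE (a : A) (f p : dual A) (x : A) :
  dd_ident (a ⊗ f) (p ⊗ x) = p a * f x.
Proof.
have bil2 b (g : dual A) : bilinear (fun (q : dual A) y => (q b * g y : k^o)).
  split=> [q c r s | q c r s]; first by rewrite /= linearP mulrDr mulrCA.
  by rewrite /= add_lfunE scale_lfunE mulrDl -mulrA.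
have bil1 (u : dual A ⊗ A) :
    bilinear (fun b (g : dual A) => \sw_(q, y <- u) (q b * g y : k^o)).
  split=> [b c g h | g c b d]; rewrite /tsum scaler_sumr -big_split /=;
    apply: eq_bigr => i _.
    by rewrite /= add_lfunE scale_lfunE mulrDr mulrCA.
  by rewrite /= linearP mulrDl -mulrA.
have lin2 (w : A ⊗ dual A) : linear (fun u : dual A ⊗ A =>
    \sw_(b, g <- w) \sw_(q, y <- u) (q b * g y : k^o)).
  move=> c u v; rewrite /tsum scaler_sumr -big_split /=.
  by apply: eq_bigr => i _; apply: (tsum_linear (bil2 _ _)).
rewrite linfunE ?linfunE ?tsumE //= => c w w'.
apply/lfunP => u; rewrite add_lfunE scale_lfunE !linfunE //.
exact: (tsum_linear (bil1 u)).
Qed.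

End Doubles.

(* Quasitriangular bialgebras: R invertible, R Δ(h) = Δ^op(h) R,              *)
(* (Δ ⊗ id)R = R13 R23 and (id ⊗ Δ)R = R13 R12.                               *)

Definition tens_inverse (k : fieldType) (B : algData k) (R U : B ⊗ B) :=
  tmul R U = aone B ⊗ aone B /\ tmul U R = aone B ⊗ aone B.

Definition is_quasitriangular (k : fieldType) (H : bialgData k) (R : H ⊗ H) :=
  [/\ is_bialgebra H,
      exists U, tens_inverse R U,
      forall h : H,
        tmul R (bcomul h) = tmul (\sw_(h1, h2 <- bcomul h) h2 ⊗ h1) R,
      \sw_(x, y <- R) \sw_(x1, x2 <- bcomul x) x1 ⊗ (x2 ⊗ y)
        = \sw_(x, y <- R) \sw_(x', y' <- R) x ⊗ (x' ⊗ amul y y')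
    & \sw_(x, y <- R) x ⊗ bcomul y
        = \sw_(x, y <- R) \sw_(x', y' <- R) amul x x' ⊗ (y' ⊗ y)].

(* H^*_R : the product of f and g is (R^2 ⇀ g)(R^1 ⇀ f). *)
Definition dual_R (k : fieldType) (H : bialgData k) (R : H ⊗ H) : algData k :=
  @AlgData k (dual H)
    (fun f g => \sw_(R1, R2 <- R) conv (@bcomul k H) (lreg R2 g) (lreg R1 f))
    (bcounit H).

Section Categories.
Variables (k : fieldType) (H : bialgData k).

Definition is_lmodule (V : vectType k) (la : H -> V -> V) :=
  [/\ bilinear la, forall v, la (aone H) v = v
    & forall h h' v, la (amul h h') v = la h (la h' v)].

Definition is_rmodule (V : vectType k) (ra : V -> H -> V) :=
  [/\ bilinear ra, forall v, ra v (aone H) = v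
    & forall h h' v, ra v (amul h h') = ra (ra v h) h'].

Definition is_bimodule (V : vectType k) (la : H -> V -> V) (ra : V -> H -> V) :=
  [/\ is_lmodule la, is_rmodule ra
    & forall h v h', ra (la h v) h' = la h (ra v h')].

(* Actions on tensor products in H_l, H_r and H_lr. *)

Definition ltens (V W : vectType k) (la : H -> V -> V) (la' : H -> W -> W)
    (h : H) (t : V ⊗ W) : V ⊗ W :=
  \sw_(h1, h2 <- bcomul h) \sw_(v, w <- t) la h1 v ⊗ la' h2 w.

Definition rtens (V W : vectType k) (ra : V -> H -> V) (ra' : W -> H -> W)
    (t : V ⊗ W) (h : H) : V ⊗ W :=
  \sw_(h1, h2 <- bcomul h) \sw_(v, w <- t) ra v h2 ⊗ ra' w h1.

Definition lrtens (V W : vectType k)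
    (la : H -> V -> V) (ra : V -> H -> V)
    (la' : H -> W -> W) (ra' : W -> H -> W)
    (h : H) (t : V ⊗ W) (h' : H) : V ⊗ W :=
  \sw_(h1, h2 <- bcomul h) \sw_(h1', h2' <- bcomul h') \sw_(v, w <- t)
    ra (la h1 v) h2' ⊗ ra' (la' h2 w) h1'.

(* An algebra in each of these tensor categories: an algebra carried by an    *)
(* object, whose multiplication B ⊗ B -> B and unit k -> B are morphisms (the *)
(* unit object k has the action(s) through the counit).                       *)

Definition algebra_in_l (B : algData k) (la : H -> B -> B) :=
  [/\ is_algebra B, is_lmodule la,
      forall h t, tmult (ltens la la h t) = la h (tmult t)
    & forall h, la h (aone B) = (bcounit H h : k) *: aone B].

Definition algebra_in_r (B : algData k) (ra : B -> H -> B) :=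
  [/\ is_algebra B, is_rmodule ra,
      forall t h, tmult (rtens ra ra t h) = ra (tmult t) h
    & forall h, ra (aone B) h = (bcounit H h : k) *: aone B].

Definition algebra_in_lr (B : algData k) (la : H -> B -> B) (ra : B -> H -> B) :=
  [/\ is_algebra B, is_bimodule la ra,
      forall h t h', tmult (lrtens la ra la ra h t h')
                     = ra (la h (tmult t)) h'
    & forall h h', ra (la h (aone B)) h'
                   = (bcounit H h * bcounit H h' : k) *: aone B].

(* The braiding of H_lr when U is the inverse of R. *)
Definition braiding_lr (R U : H ⊗ H) (V W : vectType k)
    (la : H -> V -> V) (ra : V -> H -> V)
    (la' : H -> W -> W) (ra' : W -> H -> W) (t : V ⊗ W) : W ⊗ V :=
  \sw_(v, w <- t) \sw_(R1, R2 <- R) \sw_(U1, U2 <- U)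
    ra' (la' R2 w) U1 ⊗ ra (la R1 v) U2.

Definition quantum_commutative_lr (R U : H ⊗ H) (B : algData k)
    (la : H -> B -> B) (ra : B -> H -> B) :=
  @tmult k B \o braiding_lr R U la ra la ra =1 @tmult k B.

End Categories.

(* Main.v *)
From HB Require Import structures.
From mathcomp Require Import all_boot all_order all_algebra all_field.
Require Import Defs.

Set Implicit Arguments.
Unset Strict Implicit.
Unset Printing Implicit Defensive.

Import GRing.Theory.
Local Open Scope ring_scope.
Local Open Scope tensor_scope.

(** An element of D(A) = A^* ⊗ A is the same thing as an endomorphism of the
    vector space A, with p ⊗ x acting as a |-> p(a) x ([dd_fun]), and an element
    of D(A) ⊗ D(A) is the same thing as a bilinear map from A × A to A ⊗ A
    ([dd_fun2]).
    In this picture the structure of D(A) only involves that of A: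
      - product: (u v)(a) = Σ y2 v(S^-1(y3) a2 y1), where y = u(a1)
        ([dd_fun_mul]);
      - coproduct: Δ(u)(a, b) = Δ(u(b a)) ([dd_fun2_comul]);
      - counit: u |-> ε(u(1));
      - R-matrix: (a, b) |-> ε(a) b ⊗ 1, with inverse (a, b) |-> ε(a) S(b) ⊗ 1.
    So every axiom of a quasitriangular bialgebra turns into an identity between
    iterated coproducts in A, and follows from coassociativity together with the
    cancellations y2 S^-1(y1) = ε(y) = S^-1(y2) y1.  The key ones are
    [dd_twist_mul] (associativity), [dd_twist_comul] (multiplicativity of Δ) and
    [dd_R_comul] (R intertwines Δ and its opposite).

    The Heisenberg double A # A^* is treated in the same way, with a # p acting
    as y |-> p(y) a; its product becomes (s t)(y) = Σ s(c2 y1) c1, where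
    c = t(y2) ([heis_fun_mul]).

    The product of the twisted dual H^*_R is (f g)(h) = (g ⊗ f)(Δ(h) R21), where
    R21 is R with its factors exchanged ([dual_R_pairing]).  For H = D(A) the
    formula found for Δ^op(h) R while proving that R intertwines Δ and Δ^op
    ([dd_fun2_comul_op_R]) makes this the Heisenberg product ([dd_identM]).  So
    H^*_R inherits associativity from the Heisenberg double.

    The last assertions then only rest on the invertibility of R and on
    R Δ(h) = Δ^op(h) R.  Through the pairing of H^* ⊗ H^* with H ⊗ H, the
    regular actions become left and right multiplications in H ⊗ H;
    compatibility with the left action amounts to Δ(h) R21 = R21 Δ^op(h),
    compatibility with the right action to the multiplicativity of Δ, and
    quantum commutativity to U21 Δ(h) R21 R = Δ^op(h) R, where U = R^-1.

    The formulas involve S^-1, so the bijectivity of the antipode of a finite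
    dimensional Hopf algebra comes first ([antipode_surj], [antipode_inj]). *)

(** * Multilinearity *)

Section Multilinearity.
Variable k : fieldType.
Implicit Types V W U X : vectType k.

Lemma lin_id V : linear (fun x : V => x).
Proof. by []. Qed.

Lemma lin_comp V W X (f : W -> X) (g : V -> W) :
  linear f -> linear g -> linear (fun x => f (g x)).
Proof. by move=> lin_f lin_g a u v; rewrite lin_g lin_f. Qed.

Lemma lin_op_l V W U X (f : V -> W -> U) (g : X -> V) w :
  bilinear f -> linear g -> linear (fun x => f (g x) w).
Proof. by move=> [_ lin_f] lin_g a u v; rewrite lin_g lin_f. Qed.

Lemma lin_op_r V W U X (f : V -> W -> U) v (g : X -> W) :
  bilinear f -> linear g -> linear (fun x => f v (g x)).
Proof. by move=> [lin_f _] lin_g a u w; rewrite lin_g lin_f. Qed.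

Lemma lin_scalel V X (g : X -> k) (v : V) :
  @GRing.linear_for k X k^o *:%R g -> linear (fun x => g x *: v).
Proof. by move=> lin_g a x y; rewrite lin_g scalerDl scalerA. Qed.

Lemma lin_scaler V X (c : k) (g : X -> V) :
  linear g -> linear (fun x => c *: g x).
Proof. by move=> lin_g a x y; rewrite lin_g scalerDr !scalerA mulrC. Qed.

Lemma lin_tsum_body V W U X (t : V ⊗ W) (F : X -> V -> W -> U) :
  (forall v w, linear (fun x => F x v w)) ->
  linear (fun x => \sw_(v, w <- t) F x v w).
Proof.
move=> lin_F a x y; rewrite /tsum scaler_sumr -big_split /=.
by apply: eq_bigr => i _; rewrite lin_F.
Qed.

Lemma lin_sum V X (I : finType) (F : X -> I -> V) :
  (forall i, linear (fun x => F x i)) -> linear (fun x => \sum_i F x i).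
Proof.
move=> lin_F a x y; rewrite scaler_sumr -big_split /=.
by apply: eq_bigr => i _; rewrite lin_F.
Qed.

Lemma lin_tsum V W U X (g : X -> V ⊗ W) (F : V -> W -> U) :
  bilinear F -> linear g -> linear (fun x => \sw_(v, w <- g x) F v w).
Proof. by move=> bil_F lin_g a x y; rewrite lin_g (tsum_linear bil_F). Qed.

Lemma hom_lin V W (f : 'Hom(V, W)) : linear f.
Proof. exact: linearP. Qed.

Lemma lin_eval V W X (g : X -> 'Hom(V, W)) (v : V) :
  linear g -> linear (fun x => g x v).
Proof. by move=> lin_g a x y; rewrite lin_g add_lfunE scale_lfunE. Qed.

Lemma mul_bilinear (A : falgType k) : bilinear (@GRing.mul A).
Proof.
split=> [a c x y | a c x y]; first by rewrite mulrDr scalerAr.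
by rewrite mulrDl scalerAl.
Qed.

End Multilinearity.

Arguments lin_comp {k V W X f g}.
Arguments lin_op_l {k V W U X f g w}.
Arguments lin_op_r {k V W U X f v g}.

(** A Sweedler sum can only be manipulated if its body is multilinear.  The
    tactic [multilin] proves this by following the syntax of the body, and
    [multilin_fact] is the hook through which each part of the development
    registers its own multilinear operations. *)
Ltac multilin_fact := fail.

(** In a pattern (fun x => op ?y _) the variable y may also match a term that
    depends on x; the dependency only shows when y is used. *)
Ltac is_constant f :=
  lazymatch f with (fun _ => ?c) => let closed_c := constr:(c) in idtac end.

Ltac multilin :=
  cbv beta;
  lazymatch goal with
  | |- True => exact: I
  | |- bilinear _ => first [assumption | split; multilin]
  | |- forall _, _ => intro; multilin
  | |- _ /\ _ => split; multilin
  | |- GRing.linear_for _ (fun x => x) => exact: lin_id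
  | |- GRing.linear_for _ (fun x => tsum (@?t x) _) =>
      tryif is_constant t then apply: lin_tsum_body; multilin
      else (apply: lin_tsum; multilin)
  | |- GRing.linear_for _ (fun x => bigop _ _ _) => apply: lin_sum; multilin
  | |- GRing.linear_for _ (fun x => @?c x *: _) =>
      tryif is_constant c then apply: lin_scaler; multilin
      else (apply: lin_scalel; multilin)
  | |- GRing.linear_for _ (fun x => fun_of_lfun (@?f x) _) =>
      tryif is_constant f then apply: (lin_comp (@hom_lin _ _ _ _)); multilin
      else (apply: lin_eval; multilin)
  | |- GRing.linear_for _ (fun x => tens (@?v x) _) =>
      tryif is_constant v
      then apply: (lin_op_r (@tens_bilinear _ _ _)); multilin
      else (apply: (lin_op_l (@tens_bilinear _ _ _)); multilin)
  | |- GRing.linear_for _ (fun x => @?y x * _) =>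
      tryif is_constant y
      then apply: (lin_op_r (@mul_bilinear _ _)); multilin
      else (apply: (lin_op_l (@mul_bilinear _ _)); multilin)
  | |- GRing.linear_for _ ?g =>
      first
      [ assumption
      | multilin_fact; multilin
      (* unification may have contracted the goal to a partial application *)
      | lazymatch g with
        | fun x => _ => fail
        | _ => change (linear (fun x => g x)); multilin
        end ]
  end.

(** * Sums over tensors *)

Section SumsOverTensors.
Variable k : fieldType.
Implicit Types V W U X Y : vectType k.

Lemma eq_tsum V W U (t : V ⊗ W) (F G : V -> W -> U) :
  (forall v w, F v w = G v w) -> tsum t F = tsum t G.
Proof. by move=> eqFG; apply: eq_bigr => i _; apply: eqFG. Qed.

Lemma tsum_id V W (t : V ⊗ W) : \sw_(v, w <- t) v ⊗ w = t.
Proof. by rewrite /tsum -tensor_span. Qed.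

Lemma linear_scale V W (f : V -> W) c v : linear f -> f (c *: v) = c *: f v.
Proof. by move=> lin_f; rewrite (GRing.scalable_linear lin_f). Qed.

Lemma linear_tsum V W U X (f : U -> X) (t : V ⊗ W) (F : V -> W -> U) :
  linear f -> f (tsum t F) = \sw_(v, w <- t) f (F v w).
Proof.
move=> lin_f; pose m := GRing.isLinear.Build _ _ _ _ f lin_f.
by rewrite -[f]/((HB.pack f m : {linear U -> X}) : _ -> _) linear_sum.
Qed.

Lemma hom_tsum V W U X (f : 'Hom(U, X)) (t : V ⊗ W) (F : V -> W -> U) :
  f (tsum t F) = \sw_(v, w <- t) f (F v w).
Proof. exact: linear_sum. Qed.

Lemma tsum_tsum V W X Y U (t : V ⊗ W) (F : V -> W -> X ⊗ Y)
    (G : X -> Y -> U) :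
  bilinear G ->
  tsum (tsum t F) G = \sw_(v, w <- t) \sw_(x, y <- F v w) G x y.
Proof. by move=> bil_G; apply: (linear_tsum _ _ (tsum_linear bil_G)). Qed.

Lemma homZ V W (f : 'Hom(V, W)) c v : f (c *: v) = c *: f v.
Proof. exact: linearZ. Qed.

Lemma hom_bigsum V W (f : 'Hom(V, W)) (I : finType) (F : I -> V) :
  f (\sum_i F i) = \sum_i f (F i).
Proof. exact: linear_sum. Qed.

Lemma scaler_tsuml V W U (t : V ⊗ W) (F : V -> W -> k^o) (u : U) :
  (tsum t F : k) *: u = \sw_(v, w <- t) (F v w : k) *: u.
Proof. exact: scaler_suml. Qed.

Lemma tsumZ V W U c (t : V ⊗ W) (F : V -> W -> U) :
  bilinear F -> tsum (c *: t) F = c *: tsum t F.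
Proof. by move=> bilF; rewrite (linear_scale _ _ (tsum_linear bilF)). Qed.

Lemma mulr_tsuml V W (A : falgType k) (t : V ⊗ W) (F : V -> W -> A) c :
  tsum t F * c = \sw_(v, w <- t) F v w * c.
Proof. exact: mulr_suml. Qed.

Lemma mulr_tsumr V W (A : falgType k) (t : V ⊗ W) (F : V -> W -> A) c :
  c * tsum t F = \sw_(v, w <- t) c * F v w.
Proof. exact: mulr_sumr. Qed.

Lemma scaler_tsum V W U (t : V ⊗ W) (F : V -> W -> U) (c : k) :
  c *: tsum t F = \sw_(v, w <- t) c *: F v w.
Proof. exact: scaler_sumr. Qed.

Lemma tens_tsuml V W X Y (t : V ⊗ W) (F : V -> W -> X) (y : Y) :
  tsum t F ⊗ y = \sw_(v, w <- t) F v w ⊗ y.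
Proof. by apply: (linear_tsum (f := fun x => x ⊗ y)); multilin. Qed.

Lemma tens_tsumr V W X Y (t : V ⊗ W) (F : V -> W -> Y) (x : X) :
  x ⊗ tsum t F = \sw_(v, w <- t) x ⊗ F v w.
Proof. by apply: (linear_tsum (f := fun y => x ⊗ y)); multilin. Qed.

Lemma exchange_tsum V W X Y U (t : V ⊗ W) (s : X ⊗ Y)
    (F : V -> W -> X -> Y -> U) :
  \sw_(v, w <- t) \sw_(x, y <- s) F v w x y
  = \sw_(x, y <- s) \sw_(v, w <- t) F v w x y.
Proof. exact: exchange_big. Qed.

End SumsOverTensors.

(** * Generalised coassociativity *)

Section Coassociativity.
Variables (k : fieldType) (C : vectType k) (D : C -> C ⊗ C).
Hypotheses (lin_D : linear D) (coassD : coassociative D).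
Variable U : vectType k.

(** Coassociativity is an equality between tensors; a trilinear body F factors
    through the triple tensor product, which makes it usable inside a sum. *)
Lemma coassociative_sum (F : C -> C -> C -> U) c :
  (forall x, bilinear (F x)) -> (forall y z, linear (fun x => F x y z)) ->
  \sw_(x, z <- D c) \sw_(x1, x2 <- D x) F x1 x2 z
  = \sw_(x, y <- D c) \sw_(y1, y2 <- D y) F x y1 y2.
Proof.
move=> bilF linF.
pose T x s := \sw_(y, z <- s) F x y z.
have bilT : bilinear T.
  by split=> [x|s]; [apply: tsum_linear|apply: lin_tsum_body].
have linT := tsum_linear bilT.
have := congr1 (fun t => tsum t T) (coassD c); rewrite !tsum_tsum //.
under eq_tsum => x y.
  rewrite tsum_tsum //; under eq_tsum => u v do rewrite tsumE // /T tsumE //.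
  over.
by move->; apply: eq_tsum => x y; rewrite tsumE.
Qed.

Inductive bracketing := Leaf | Node (l r : bracketing).

Fixpoint leaves (t : bracketing) : nat :=
  if t is Node l r then (leaves l + leaves r)%N else 1%N.

(** The Sweedler sum in which the successive coproducts are taken in the order
    recorded by the bracketing t; its body K receives the list of the factors
    from left to right.  For a concrete t this computes to nested [\sw] sums, so
    that [rebracket] applies to nested sums up to conversion. *)
Fixpoint sw_tree (t : bracketing) (c : C) (K : seq C -> U) : U :=
  match t with
  | Leaf => K [:: c]
  | Node l r => \sw_(x, y <- D c)
      sw_tree l x (fun s => sw_tree r y (fun s' => K (s ++ s')))
  end.

(** The tail s has arbitrary length, and not the length that K expects: for a
    body that accesses its arguments with [nth], the condition then computes to
    one linearity goal for each argument. *)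
Fixpoint multilinear (n : nat) (K : seq C -> U) : Prop :=
  if n is m.+1 then (forall s, linear (fun x => K (x :: s)))
                    /\ (forall x, multilinear m (fun s => K (x :: s)))
  else True.

Lemma eq_sw_tree t c K K' :
  (forall s, size s = leaves t -> K s = K' s) ->
  sw_tree t c K = sw_tree t c K'.
Proof.
elim: t c K K' => [|l IHl r IHr] c K K' eqK /=; first exact: eqK.
apply: eq_tsum => x y; apply: IHl => s sz_s; apply: IHr => s' sz_s'.
by apply: eqK; rewrite size_cat sz_s sz_s'.
Qed.

Lemma sw_tree_body (X : vectType k) t c (K : X -> seq C -> U) :
  (forall s, size s = leaves t -> linear (fun x => K x s)) ->
  linear (fun x => sw_tree t c (K x)).
Proof.
elim: t c K => [|l IHl r IHr] c K linK /=; first exact: linK.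
apply: lin_tsum_body => v w; apply: IHl => s sz_s; apply: IHr => s' sz_s'.
by apply: linK; rewrite size_cat sz_s sz_s'.
Qed.

Lemma multilinear_cat n K s :
  multilinear (size s + n) K -> multilinear n (fun s' => K (s ++ s')).
Proof. by elim: s K => //= x s IHs K [_ /(_ x)]; apply: IHs. Qed.

Lemma multilinear_catr m n K s' :
  multilinear (m + n) K -> multilinear m (fun s => K (s ++ s')).
Proof.
elim: m K => //= m IHm K [lin1 linK]; split=> [s|x]; first exact: lin1.
exact: (IHm (fun s => K (x :: s))).
Qed.

Lemma multilinear_sw_tree m t c (K : seq C -> seq C -> U) :
  (forall s', multilinear m (fun s => K s s')) ->
  multilinear m (fun s => sw_tree t c (K s)).
Proof.
elim: m K => //= m IHm K linK; split=> [s|x].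
  by apply: sw_tree_body => s' _; case: (linK s') => lin1 _; apply: lin1.
by apply: (IHm (fun s => K (x :: s))) => s'; case: (linK s').
Qed.

Lemma linear_sw_tree t K :
  multilinear (leaves t) K -> linear (fun c => sw_tree t c K).
Proof.
elim: t K => [|l IHl r IHr] K /= mK; first by case: mK => lin1 _; apply: lin1.
apply: lin_tsum; last exact: lin_comp lin_D (@lin_id _ _).
split=> [x|y]; last first.
  apply: IHl; apply: multilinear_sw_tree => s'.
  exact: multilinear_catr mK.
apply: sw_tree_body => s sz_s; apply: IHr.
by apply: multilinear_cat; rewrite sz_s.
Qed.

Lemma exchange_sw_tree (X Y : vectType k) (u : X ⊗ Y) t c
    (K : X -> Y -> seq C -> U) :
  \sw_(x, y <- u) sw_tree t c (K x y)
  = sw_tree t c (fun s => \sw_(x, y <- u) K x y s).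
Proof.
elim: t c K => //= l IHl r IHr c K; rewrite exchange_tsum.
apply: eq_tsum => v w; rewrite IHl; apply: eq_sw_tree => s _; exact: IHr.
Qed.

Lemma sw_tree_assoc l m r c K :
  multilinear (leaves l + (leaves m + leaves r)) K ->
  sw_tree (Node (Node l m) r) c K = sw_tree (Node l (Node m r)) c K.
Proof.
move=> mK /=.
under eq_tsum => x y.
  under eq_tsum => u v.
    under eq_sw_tree => s _.
      under eq_sw_tree => s' _ do under eq_sw_tree => s'' _ do rewrite -catA.
      over.
    over.
  over.
rewrite /= (@coassociative_sum (fun u v w => sw_tree l u (fun s =>
  sw_tree m v (fun s' => sw_tree r w (fun s'' => K (s ++ (s' ++ s''))))))).
- by apply: eq_tsum => x y /=; rewrite exchange_sw_tree.
- move=> x; split=> [y|y].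
    apply: sw_tree_body => s sz_s; apply: sw_tree_body => s' sz_s'.
    apply: linear_sw_tree; apply: (multilinear_cat (K := fun t => K (s ++ t))).
    by apply: multilinear_cat; rewrite sz_s sz_s'.
  apply: sw_tree_body => s sz_s; apply: linear_sw_tree.
  apply: multilinear_sw_tree => s'.
  apply: (multilinear_catr (n := leaves r) (K := fun t => K (s ++ t))).
  by apply: multilinear_cat; rewrite sz_s.
- move=> y z; apply: linear_sw_tree; apply: multilinear_sw_tree => s'.
  by apply: multilinear_sw_tree => s''; apply: multilinear_catr mK.
Qed.

Fixpoint right_comb (n : nat) : bracketing :=
  if n is m.+1 then Node Leaf (right_comb m) else Leaf.

Lemma leaves_right_comb n : leaves (right_comb n) = n.+1.
Proof. by elim: n => //= n ->. Qed.

Lemma sw_tree_comb_cat m n c K :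
  multilinear (m.+1 + n.+1) K ->
  sw_tree (Node (right_comb m) (right_comb n)) c K
  = sw_tree (right_comb (m + n).+1) c K.
Proof.
elim: m c K => [|m IHm] c K mK //.
rewrite -[right_comb m.+1]/(Node Leaf (right_comb m)) sw_tree_assoc; last first.
  by rewrite /= !leaves_right_comb.
case: mK => _ mK; apply: eq_tsum => x y.
by apply: (IHm _ (fun s => K (x :: s))); apply: mK.
Qed.

Lemma sw_tree_comb t c K :
  multilinear (leaves t) K ->
  sw_tree t c K = sw_tree (right_comb (leaves t).-1) c K.
Proof.
elim: t c K => // l IHl r IHr c K mK.
have leaves_gt0 t : (0 < leaves t)%N.
  by elim: t => //= t1 ? t2 ?; rewrite addn_gt0; apply/orP; left.
rewrite /= in mK *; transitivity (sw_tree
  (Node (right_comb (leaves l).-1) (right_comb (leaves r).-1)) c K).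
  apply: eq_tsum => x y; rewrite IHl; last first.
    by apply: multilinear_sw_tree => s'; apply: multilinear_catr mK.
  apply: eq_sw_tree => s; rewrite leaves_right_comb prednK // => sz_s.
  by rewrite IHr //; apply: multilinear_cat; rewrite sz_s.
rewrite sw_tree_comb_cat ?prednK //.
congr (sw_tree (right_comb _) c K).
by case: leaves (leaves_gt0 l) => // a _; case: leaves (leaves_gt0 r) => // b _;
  rewrite /= addnS.
Qed.

(** Bracketings with the same number of leaves all give the sum of the right
    comb, by moving one subtree at a time to the right. *)
Lemma rebracket t t' c K :
  leaves t = leaves t' -> multilinear (leaves t) K ->
  sw_tree t c K = sw_tree t' c K.
Proof.
by move=> eq_tt' mK; rewrite sw_tree_comb // eq_tt' -sw_tree_comb -?eq_tt'.
Qed.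

End Coassociativity.

(** * Hopf algebra axioms under Sweedler sums *)

Section TensorSquareAlgebra.
Variables (k : fieldType) (B : algData k).
Hypothesis alg_B : is_algebra B.

Lemma amul_bilinear : bilinear (@amul k B). Proof. by case: alg_B. Qed.

Lemma amulA (x y z : B) : amul x (amul y z) = amul (amul x y) z.
Proof. by case: alg_B. Qed.

Lemma amul1 (x : B) : amul (aone B) x = x.
Proof. by case: alg_B => _ _ /(_ x) []. Qed.

Lemma amulr1 (x : B) : amul x (aone B) = x.
Proof. by case: alg_B => _ _ /(_ x) []. Qed.

Ltac multilin_fact ::=
  first [apply: (lin_op_l amul_bilinear) | apply: (lin_op_r amul_bilinear)].

Lemma tmul_bilinear : bilinear (@tmul k B).
Proof. by rewrite /tmul; split=> [s|t]; multilin. Qed.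

Lemma tmulE (x y x' y' : B) :
  tmul (x ⊗ y) (x' ⊗ y') = amul x x' ⊗ amul y y'.
Proof. by rewrite /tmul !tsumE //; multilin. Qed.

Lemma tmulA (r s t : B ⊗ B) : tmul r (tmul s t) = tmul (tmul r s) t.
Proof.
rewrite /tmul tsum_tsum; last by multilin.
apply: eq_tsum => x y; rewrite tsum_tsum; last by multilin.
rewrite [RHS]tsum_tsum; last by multilin.
apply: eq_tsum => x' y'; rewrite tsum_tsum; last by multilin.
rewrite tsumE; last by multilin.
by apply: eq_tsum => x'' y''; rewrite tsumE; [rewrite !amulA|multilin].
Qed.

Lemma tmul1 (t : B ⊗ B) : tmul (aone B ⊗ aone B) t = t.
Proof.
rewrite /tmul tsumE; last by multilin.
by under eq_tsum => x y do rewrite !amul1; rewrite tsum_id.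
Qed.

Lemma tmulr1 (t : B ⊗ B) : tmul t (aone B ⊗ aone B) = t.
Proof.
rewrite /tmul; under eq_tsum => x y.
  by rewrite tsumE; [rewrite !amulr1; over | multilin].
by rewrite tsum_id.
Qed.

Lemma sw_tmul (U : vectType k) (s t : B ⊗ B) (F : B -> B -> U) :
  bilinear F ->
  \sw_(x, y <- tmul s t) F x y
  = \sw_(x, y <- s) \sw_(x', y' <- t) F (amul x x') (amul y y').
Proof.
move=> bilF; rewrite /tmul tsum_tsum //; apply: eq_tsum => x y.
by rewrite tsum_tsum //; apply: eq_tsum => x' y'; rewrite tsumE.
Qed.

End TensorSquareAlgebra.

Section HopfSums.
Variables (k : fieldType) (A : hopfAlgType k).
Implicit Types (a b : A) (U : vectType k).

Let bialgA := @hopf_bialgebra k A.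

Lemma comul_coassoc : coassociative (@comul k A).
Proof. by case: bialgA => _ [_ ? _]. Qed.

Lemma sw_comulM U a b (F : A -> A -> U) : bilinear F ->
  \sw_(x, y <- comul (a * b)) F x y
  = \sw_(a1, a2 <- comul a) \sw_(b1, b2 <- comul b) F (a1 * b1) (a2 * b2).
Proof.
case: bialgA => _ _ [comulM _] _ bilF.
by rewrite [comul (a * b)]comulM; apply: (@sw_tmul k (alg_of A)).
Qed.

Lemma sw_comul1 U (F : A -> A -> U) :
  bilinear F -> \sw_(x, y <- comul (1 : A)) F x y = F 1 1.
Proof.
by case: bialgA => _ _ [_ comul1] _ bilF; rewrite [comul 1]comul1 tsumE.
Qed.

Lemma counitM a b : counit (a * b) = (counit a : k) * counit b.
Proof. by case: bialgA => _ _ _ [-> _]. Qed.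

Lemma counit1 : counit (1 : A) = 1.
Proof. by case: bialgA => _ _ _ [_]. Qed.

Lemma sw_counitl U a (f : A -> U) : linear f ->
  \sw_(x, y <- comul a) (counit x : k) *: f y = f a.
Proof.
case: bialgA => _ [_ _ counA] _ _ lin_f.
rewrite -[in RHS](proj1 (counA a)) (linear_tsum _ _ lin_f).
apply: eq_tsum => x y /=.
by rewrite (linear_scale _ _ lin_f).
Qed.

Lemma sw_counitr U a (f : A -> U) : linear f ->
  \sw_(x, y <- comul a) (counit y : k) *: f x = f a.
Proof.
case: bialgA => _ [_ _ counA] _ _ lin_f.
rewrite -[in RHS](proj2 (counA a)) (linear_tsum _ _ lin_f).
apply: eq_tsum => x y /=.
by rewrite (linear_scale _ _ lin_f).
Qed.

Lemma sw_antipodel U a (f : A -> U) : linear f ->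
  \sw_(x, y <- comul a) f (antipode x * y) = (counit a : k) *: f 1.
Proof.
move=> lin_f; rewrite -(linear_tsum _ _ lin_f) (proj1 (antipode_axiom a)).
by rewrite (linear_scale _ _ lin_f).
Qed.

Lemma sw_antipoder U a (f : A -> U) : linear f ->
  \sw_(x, y <- comul a) f (x * antipode y) = (counit a : k) *: f 1.
Proof.
move=> lin_f; rewrite -(linear_tsum _ _ lin_f) (proj2 (antipode_axiom a)).
by rewrite (linear_scale _ _ lin_f).
Qed.

Lemma comul_rebracket U t t' a (K : seq A -> U) :
  leaves t = leaves t' -> multilinear (leaves t) K ->
  sw_tree (@comul k A) t a K = sw_tree (@comul k A) t' a K.
Proof. exact: rebracket (@hom_lin _ _ _ _) comul_coassoc _ _ _ _ _. Qed.

Lemma antipode1 : antipode (1 : A) = 1.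
Proof.
have := sw_antipodel 1 (@lin_id _ A); rewrite sw_comul1; last by multilin.
by rewrite mulr1 counit1 scale1r.
Qed.

End HopfSums.

Arguments sw_counitl {k A U a f}.
Arguments sw_counitr {k A U a f}.
Arguments sw_antipodel {k A U a f}.
Arguments sw_antipoder {k A U a f}.

(** * Bijectivity of the antipode *)

#[local] Hint Extern 0 (GRing.linear_for _ _) => solve [multilin] : core.
#[local] Hint Extern 0 (bilinear _) => solve [multilin] : core.

Section Antipode.
Variables (k : fieldType) (A : hopfAlgType k).
Implicit Types (a b : A) (U : vectType k).

Let coassoc U := coassociative_sum (@comul_coassoc k A) (U := U).

(** S(b) S(a) becomes S(b1) S(a1) (a2 b2) S(a3 b3) by inserting a counit, and
    then S(a b) by cancelling S(a1) a2 and S(b1) b2. *)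
Lemma antipodeM a b : antipode (a * b) = antipode b * antipode a.
Proof.
transitivity (\sw_(a1, a2 <- comul a) \sw_(b1, b2 <- comul b)
  \sw_(u, v <- comul (a2 * b2)) antipode b1 * antipode a1 * (u * antipode v)).
  under [RHS]eq_tsum => a1 a2.
    under eq_tsum => b1 b2 do rewrite sw_comulM //.
    rewrite exchange_tsum; over.
  rewrite -(coassoc (F := fun x y z => \sw_(b1, b2 <- comul b)
    \sw_(u, v <- comul b2)
       antipode b1 * antipode x * (y * u * antipode (z * v)))) //.
  under [RHS]eq_tsum => x z.
    under eq_tsum => x1 x2.
      under eq_tsum => b1 b2 do under eq_tsum => u v do
        rewrite !mulrA -(mulrA (antipode b1)).
      over.
    rewrite (sw_antipodel (f := fun w => \sw_(b1, b2 <- comul b)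
      \sw_(u, v <- comul b2) antipode b1 * w * u * antipode (z * v))) //.
    over.
  rewrite sw_counitl // -(coassoc (F := fun x y z =>
    antipode x * 1 * y * antipode (a * z))) //.
  under [RHS]eq_tsum => x z.
    under eq_tsum => x1 x2 do rewrite mulr1.
    rewrite (sw_antipodel (f := fun w => w * antipode (a * z))) //.
    over.
  by rewrite sw_counitl // mul1r.
under eq_tsum => a1 a2.
  under eq_tsum => b1 b2.
    rewrite (sw_antipoder (f := fun w => antipode b1 * antipode a1 * w)) //.
    rewrite mulr1 counitM mulrC -scalerA; over.
  rewrite sw_counitr -?scaler_tsum //; over.
by rewrite sw_counitr.
Qed.

Let S := @antipode k A.
Let unitA : 'End(A) := linfun (fun a => (counit a : k) *: 1).

(** Left convolution by S is injective on End(A), since convolution by the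
    identity undoes it.  As S reverses products, it maps the space of the
    endomorphisms S \o g into itself, hence onto itself by finite dimension.
    The unit of the convolution algebra belongs to this space, and its preimage
    is the identity, which is therefore of the form S \o g. *)
Lemma antipode_surj : exists g : 'End(A), forall a, antipode (g a) = a.
Proof.
pose conv_S (f : 'End(A)) : 'End(A) :=
  linfun (fun a => \sw_(x, y <- comul a) S x * f y).
have conv_SE f a : conv_S f a = \sw_(x, y <- comul a) S x * f y.
  by rewrite linfunE.
have conv_SK f a : \sw_(x, y <- comul a) x * conv_S f y = f a.
  under eq_tsum => x y.
    rewrite conv_SE mulr_tsumr; under eq_tsum => u v do rewrite mulrA; over.
  rewrite -(coassoc (F := fun u v w => u * S v * f w)) //.
  under eq_tsum => x y.
    by rewrite (sw_antipoder (f := fun w => w * f y)) // mul1r; over.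
  by rewrite sw_counitl.
have lin_T : linear conv_S.
  move=> c f g; apply/lfunP => a; rewrite add_lfunE scale_lfunE !conv_SE.
  have lin_a : linear (fun f : 'End(A) => \sw_(x, y <- comul a) S x * f y).
    by multilin.
  exact: lin_a.
pose T : 'End('End(A)) := linfun conv_S.
pose P : 'End('End(A)) := linfun (fun g : 'End(A) => (S \o g)%VF).
have PE g : P g = (S \o g)%VF.
  rewrite linfunE // => c f h; apply/lfunP => a.
  by rewrite add_lfunE scale_lfunE !comp_lfunE add_lfunE scale_lfunE linearP.
have kerT : lker T == 0%VS.
  apply/lker0P => f g; rewrite !(linfunE lin_T) => eqTfg; apply/lfunP => a.
  by rewrite -[RHS]conv_SK -eqTfg conv_SK.
have TW : (T @: limg P = limg P)%VS.
  apply/eqP; rewrite eqEdim (limg_dim_eq (f := T)) ?leqnn ?andbT //; last first.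
    by apply/eqP; rewrite (eqP kerT) capv0.
  apply/subvP => _ /memv_imgP[_ /memv_imgP[g _ ->] ->].
  (* S(x) S(g(y)) = S(g(y) x) *)
  pose h : 'End(A) := linfun (fun a => \sw_(x, y <- comul a) g y * x).
  suff -> : T (P g) = P h by apply: memv_img (memvf _).
  apply/lfunP => a; rewrite !PE (linfunE lin_T) conv_SE comp_lfunE linfunE //.
  rewrite hom_tsum; apply: eq_tsum => x y; rewrite comp_lfunE.
  by rewrite /S antipodeM.
have : unitA \in (T @: limg P)%VS.
  rewrite TW; apply/memv_imgP; exists unitA; rewrite ?memvf // PE.
  by apply/lfunP => a; rewrite comp_lfunE linfunE // linearZ /= /S antipode1.
case/memv_imgP => _ /memv_imgP[g _ ->] unitTg; exists g => a.
have := conv_SK (P g) a; rewrite -(linfunE lin_T) -/T -unitTg PE comp_lfunE.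
move=> <-.
under eq_tsum => x y do rewrite linfunE // -scalerAr mulr1.
by rewrite sw_counitr.
Qed.

Lemma antipode_inj : lker (@antipode k A) == 0%VS.
Proof.
have [g gK] := antipode_surj.
have: limg antipode = {:A}%VS.
  apply/eqP; rewrite eqEsubv subvf; apply/subvP => a _.
  by rewrite -(gK a) memv_img ?memvf.
move=> imS; have := limg_ker_dim (@antipode k A) {:A}.
by rewrite imS capfv => /eqP; rewrite -[X in _ == X]add0n eqn_add2r dimv_eq0.
Qed.

Lemma antipodeK : cancel (@antipode k A) (antipode^-1)%VF.
Proof. exact: lker0_lfunK antipode_inj. Qed.

Lemma antipodeVK : cancel (antipode^-1)%VF (@antipode k A).
Proof. exact: lker0_lfunVK antipode_inj. Qed.

End Antipode.

(** * The antipode and the coproduct *)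

Local Notation Si := (antipode^-1)%VF.

Section AntipodeComul.
Variables (k : fieldType) (A : hopfAlgType k).
Implicit Types (a b : A) (U : vectType k).

Let coassoc U := coassociative_sum (@comul_coassoc k A) (U := U).
Let alg_A : is_algebra (alg_of A).
Proof. by case: (@hopf_bialgebra k A). Qed.
Let tmul_A := @tmul k (alg_of A).
Let tmul_bil : bilinear tmul_A := tmul_bilinear alg_A.

Ltac multilin_fact ::=
  first [apply: (lin_op_l tmul_bil) | apply: (lin_op_r tmul_bil)].

(** Both sides are convolution inverses of Δ in Hom(A, A ⊗ A): the right-hand
    side G is a left inverse (GD), and Δ \o S is a right inverse (DD). *)
Lemma comul_antipode a :
  comul (antipode a) = \sw_(x, y <- comul a) antipode y ⊗ antipode x.
Proof.
pose G a := \sw_(x, y <- comul a) antipode y ⊗ antipode x.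
have linG : linear G by rewrite /G.
have comulM x y : comul (x * y) = tmul_A (comul x) (comul y).
  by case: (@hopf_bialgebra k A) => _ _ [DM _] _; apply: DM.
have comul1 : comul 1 = (1 : A) ⊗ (1 : A).
  by case: (@hopf_bialgebra k A) => _ _ [_ D1] _; exact: D1.
have GD b : \sw_(x, y <- comul b) tmul_A (G x) (comul y)
            = (counit b : k) *: ((1 : A) ⊗ (1 : A)).
  transitivity (sw_tree (@comul k A) (Node (Node Leaf Leaf) (Node Leaf Leaf)) b
    (fun s => (antipode s`_1 * s`_2) ⊗ (antipode s`_0 * s`_3))).
    apply: eq_tsum => x y; rewrite /G (linear_tsum (f := tmul_A^~ _)) //.
    apply: eq_tsum => u v /=; rewrite -[in LHS](tsum_id (comul y)).
    rewrite (linear_tsum (f := tmul_A _)) //; apply: eq_tsum => x' y'.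
    exact: (tmulE alg_A).
  rewrite (comul_rebracket (t' := Node Leaf (Node (Node Leaf Leaf) Leaf))) //=.
    under eq_tsum => x y.
      under eq_tsum => u v.
        rewrite (sw_antipodel (f := fun w => w ⊗ (antipode x * v))) //; over.
      rewrite sw_counitl //; over.
    by rewrite (sw_antipodel (f := fun w => 1 ⊗ w)).
have DD b : \sw_(x, y <- comul b) tmul_A (comul x) (comul (antipode y))
            = (counit b : k) *: ((1 : A) ⊗ (1 : A)).
  under eq_tsum => x y do rewrite -comulM.
  by rewrite (sw_antipoder (f := fun w => comul w)) // comul1.
transitivity (\sw_(x, y <- comul a) \sw_(u, v <- comul y)
   tmul_A (G x) (tmul_A (comul u) (comul (antipode v)))).
  under [RHS]eq_tsum => x y do under eq_tsum => u v do
    rewrite [tmul_A _ (tmul_A _ _)](tmulA alg_A).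
  rewrite -(coassoc (F := fun u v y =>
     tmul_A (tmul_A (G u) (comul v)) (comul (antipode y)))) //.
  under [RHS]eq_tsum => x y.
    rewrite -(linear_tsum (f := tmul_A^~ _)) // GD.
    rewrite (linear_scale _ _ (proj2 tmul_bil _)) [tmul_A _ _](tmul1 alg_A).
    over.
  by rewrite sw_counitl.
under eq_tsum => x y.
  rewrite -(linear_tsum (f := tmul_A _)) // DD.
  rewrite (linear_scale _ _ (proj1 tmul_bil _)) [tmul_A _ _](tmulr1 alg_A).
  over.
by rewrite sw_counitr.
Qed.

Lemma antipodeVM a b : Si (a * b) = Si b * Si a.
Proof.
by rewrite -{1}(antipodeVK a) -{1}(antipodeVK b) -antipodeM antipodeK.
Qed.

Lemma comul_antipodeV a :
  comul (Si a) = \sw_(x, y <- comul a) Si y ⊗ Si x.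
Proof.
rewrite -{2}(antipodeVK a) comul_antipode tsum_tsum //.
under [RHS]eq_tsum => x y do rewrite tsumE // !antipodeK.
by rewrite tsum_id.
Qed.

Lemma antipodeV1 : Si (1 : A) = 1.
Proof. by rewrite -{1}(antipode1 A) antipodeK. Qed.

Lemma sw_antipodeVl U a (f : A -> U) : linear f ->
  \sw_(x, y <- comul a) f (Si y * x) = (counit a : k) *: f 1.
Proof.
move=> lin_f; rewrite -antipodeV1 -(sw_antipodel (f := fun w => f (Si w))).
  by apply: eq_tsum => x y; rewrite antipodeVM antipodeK.
exact: lin_comp lin_f (@hom_lin _ _ _ _).
Qed.

Lemma sw_antipodeVr U a (f : A -> U) : linear f ->
  \sw_(x, y <- comul a) f (y * Si x) = (counit a : k) *: f 1.
Proof.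
move=> lin_f; rewrite -antipodeV1 -(sw_antipoder (f := fun w => f (Si w))).
  by apply: eq_tsum => x y; rewrite antipodeVM antipodeK.
exact: lin_comp lin_f (@hom_lin _ _ _ _).
Qed.

End AntipodeComul.
Arguments sw_antipodeVl {k A U a f}.
Arguments sw_antipodeVr {k A U a f}.

(** * Separating families of linear maps *)

Section Separation.
Variable k : fieldType.
Implicit Types V W : vectType k.

(** A family of linear maps that jointly determine their argument, together with
    a finite reconstruction formula: the formula, unlike mere joint injectivity,
    passes at once to tensor products ([separating_tens]). *)
Definition separating (I : Type) V V' (f : I -> V -> V') : Prop :=
  (forall i, linear (f i)) /\
  exists (J : finType) (idx : J -> I) (r : J -> V' -> V),
    (forall j, linear (r j)) /\ forall v, v = \sum_j r j (f (idx j) v).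

Lemma tensZl V W c (v : V) (w : W) : (c *: v) ⊗ w = c *: (v ⊗ w).
Proof. by apply: (linear_scale (f := fun v => v ⊗ w)). Qed.

Lemma tensZr V W c (v : V) (w : W) : v ⊗ (c *: w) = c *: (v ⊗ w).
Proof. by apply: (linear_scale (f := fun w => v ⊗ w)). Qed.

Lemma linear_bigsum V W (f : V -> W) (I : finType) (F : I -> V) :
  linear f -> f (\sum_i F i) = \sum_i f (F i).
Proof.
move=> lin_f; pose m := GRing.isLinear.Build _ _ _ _ f lin_f.
by rewrite -[f]/((HB.pack f m : {linear V -> W}) : _ -> _) linear_sum.
Qed.

Lemma separating_inj I V V' (f : I -> V -> V') u v :
  separating f -> (forall i, f i u = f i v) -> u = v.
Proof.
case=> _ [J [idx [r [_ rK]]]] eqf; rewrite [u]rK [v]rK.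
by apply: eq_bigr => j _; rewrite eqf.
Qed.

Lemma separating_tens I J V V' W W' (f : I -> V -> V') (g : J -> W -> W') :
  separating f -> separating g ->
  separating (fun ij (t : V ⊗ W) => \sw_(v, w <- t) f ij.1 v ⊗ g ij.2 w).
Proof.
case=> lin_f [Jf [idf [r [lin_r rK]]]] [lin_g [Jg [idg [s [lin_s sK]]]]].
have bil_fg i j : bilinear (fun v w => f i v ⊗ g j w).
  split=> [v|w]; last first.
    exact: (lin_op_l (@tens_bilinear _ _ _) (lin_f i)).
  exact: (lin_op_r (@tens_bilinear _ _ _) (lin_g j)).
have bil_rs i j : bilinear (fun v w => r i v ⊗ s j w).
  split=> [v|w]; last first.
    exact: (lin_op_l (@tens_bilinear _ _ _) (lin_r i)).
  exact: (lin_op_r (@tens_bilinear _ _ _) (lin_s j)).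
split=> [ij|]; first exact: tsum_linear.
exists (Jf * Jg)%type, (fun ij => (idf ij.1, idg ij.2)),
  (fun ij t => \sw_(v, w <- t) r ij.1 v ⊗ s ij.2 w).
split=> [ij|t]; first exact: tsum_linear.
under eq_bigr => ij _.
  rewrite tsum_tsum //; under eq_tsum => v w do rewrite tsumE //.
  over.
rewrite [RHS]exchange_big /= -[LHS]tsum_id; apply: eq_bigr => m _.
move: (vbas m) (_ (dbas m)) => v w.
rewrite {1}[v]rK {1}[w]sK (linear_bigsum (f := fun x => x ⊗ _)) //.
rewrite -(pair_bigA _ (fun i j => r i (f (idf i) v) ⊗ s j (g (idg j) w))) /=.
apply: eq_bigr => i _.
exact: (linear_bigsum (f := fun y => _ ⊗ y)).
Qed.

End Separation.

Section RegularActions.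
Variables (k : fieldType) (B : algData k).
Hypothesis alg_B : is_algebra B.

Lemma lregE h (p : dual B) (x : B) : lreg h p x = p (amul x h).
Proof.
rewrite linfunE //; apply: (lin_comp (@hom_lin _ _ _ p)).
exact: (lin_op_l (amul_bilinear alg_B) (@lin_id _ _)).
Qed.

Lemma rregE h (p : dual B) (x : B) : rreg p h x = p (amul h x).
Proof.
rewrite linfunE //; apply: (lin_comp (@hom_lin _ _ _ p)).
exact: (lin_op_r (amul_bilinear alg_B) (@lin_id _ _)).
Qed.

End RegularActions.

(** * The Drinfel'd double as endomorphisms *)

Section DoubleAsEndomorphisms.
Variables (k : fieldType) (A : hopfAlgType k).
Implicit Types (a b : A) (u v : dual A ⊗ A).
(** The identification of D(A) = A^* ⊗ A with the endomorphisms of A. *)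
Definition dd_fun u a : A := \sw_(p, x <- u) (p a : k) *: x.

Lemma dd_fun_bilinear : bilinear dd_fun.
Proof. by rewrite /dd_fun; split=> [u|a]; multilin. Qed.

Ltac multilin_fact ::=
  first [apply: (lin_op_l dd_fun_bilinear) | apply: (lin_op_r dd_fun_bilinear)].

Lemma dd_funE p x a : dd_fun (p ⊗ x) a = (p a : k) *: x.
Proof. by rewrite /dd_fun tsumE. Qed.

Lemma dd_fun_separating : separating (fun a u => dd_fun u a).
Proof.
split=> [a|]; first by multilin.
exists 'I_(\dim {:A}), (@vbas k A), (fun i x => dbas i ⊗ x).
split=> [i|u]; first by multilin.
rewrite /dd_fun; under eq_bigr => i _ do rewrite tens_tsumr.
rewrite [RHS]exchange_big -[LHS]tsum_id; apply: eq_bigr => m _ /=.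
move: (vbas m) (_ (dbas m)) => p x.
rewrite {1}[p]dual_sum (linear_bigsum (f := fun q => q ⊗ x)) //.
by apply: eq_bigr => i _; rewrite tensZl tensZr.
Qed.

(** The product of D(A) is (u v)(a) = Σ dd_twist v (u(a1)) a2.  Having y in
    place of u(a1) makes associativity a statement about one iterated coproduct,
    that of y ([dd_twist_mul]). *)
Definition dd_twist v y b : A :=
  \sw_(y1, y23 <- comul y) \sw_(y2, y3 <- comul y23)
    y2 * dd_fun v (Si y3 * b * y1).

Lemma dual_convE (p q : dual A) a :
  dual_conv p q a = \sw_(x, y <- comul a) (p x * q y : k^o).
Proof. by rewrite linfunE. Qed.

Lemma scale_dual_conv (U : vectType k) (p q : dual A) a (w : U) :
  (dual_conv p q a : k) *: w
  = \sw_(x, y <- comul a) (p x : k) *: ((q y : k) *: w).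
Proof.
rewrite dual_convE /tsum scaler_suml.
by apply: eq_bigr => i _; rewrite scalerA.
Qed.

Lemma conjg_regE a (p : dual A) b x : conjg_reg a p b x = p (b * x * a).
Proof.
have alg_A : is_algebra (alg_of A) by case: (@hopf_bialgebra k A).
exact: etrans (rregE alg_A _ _ _) (lregE alg_A _ _ _).
Qed.

(** Evaluating p (x1 ⇀ p' ↼ S^-1(x3)) at a unfolds the convolution of A^* into a
    coproduct of a and the regular actions into products of A. *)
Lemma dd_fun_mul u v a :
  dd_fun (dd_mul u v) a
  = \sw_(a1, a2 <- comul a) dd_twist v (dd_fun u a1) a2.
Proof.
rewrite /dd_mul (linear_tsum (f := dd_fun^~ a)) //.
have lin_tw b : linear (fun y => dd_twist v y b).
  by rewrite /dd_twist; multilin.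
under [RHS]eq_tsum => a1 a2 do
  rewrite {1}/dd_fun (linear_tsum (f := fun y => dd_twist v y a2)) //.
rewrite [RHS]exchange_tsum; apply: eq_tsum => p x.
under [RHS]eq_tsum => a1 a2.
  rewrite (linear_scale _ _ (lin_tw a2)) /dd_twist.
  rewrite scaler_tsum; under eq_tsum => x1 x23.
    rewrite scaler_tsum; under eq_tsum => x2 x3.
      rewrite mulr_tsumr scaler_tsum.
      under eq_tsum => p' a' do rewrite -scalerAr.
      over.
    rewrite exchange_tsum; over.
  rewrite exchange_tsum; over.
rewrite [RHS]exchange_tsum (linear_tsum (f := dd_fun^~ a)) //.
apply: eq_tsum => p' a'.
rewrite [RHS]exchange_tsum (linear_tsum (f := dd_fun^~ a)) //.
apply: eq_tsum => x1 x23.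
rewrite [RHS]exchange_tsum (linear_tsum (f := dd_fun^~ a)) //.
apply: eq_tsum => x2 x3; rewrite dd_funE scale_dual_conv.
by apply: eq_tsum => b1 b2; rewrite conjg_regE.
Qed.

End DoubleAsEndomorphisms.

(** * Associativity of the Drinfel'd double *)

Section Twist.
Variables (k : fieldType) (A : hopfAlgType k).
Implicit Types (a b y : A) (v : dual A ⊗ A).

Ltac multilin_fact ::=
  first [ apply: (lin_op_l (@dd_fun_bilinear _ _))
        | apply: (lin_op_r (@dd_fun_bilinear _ _)) ].

Lemma dd_twist_bilinear v : bilinear (dd_twist v).
Proof. by rewrite /dd_twist; split=> [y|b]; multilin. Qed.

Lemma dd_twist_linear y b : linear (fun v => dd_twist v y b).
Proof. by rewrite /dd_twist; multilin. Qed.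

Lemma lin_dd_twist (X : vectType k) (g : X -> (dual A ⊗ A)%type) y b :
  linear g -> linear (fun x => dd_twist (g x) y b).
Proof. exact: lin_comp (dd_twist_linear y b). Qed.

End Twist.

Ltac multilin_fact ::=
  lazymatch goal with
  | |- GRing.linear_for _ (fun x => dd_fun (@?u x) _) =>
      tryif is_constant u then apply: (lin_op_r (@dd_fun_bilinear _ _))
      else apply: (lin_op_l (@dd_fun_bilinear _ _))
  | |- GRing.linear_for _ (fun x => dd_twist (@?v x) (@?y x) _) =>
      tryif is_constant v then
        tryif is_constant y then apply: (lin_op_r (dd_twist_bilinear _))
        else apply: (lin_op_l (dd_twist_bilinear _))
      else apply: lin_dd_twist
  end.

Section DrinfeldBialgebra.
Variables (k : fieldType) (A : hopfAlgType k).
Implicit Types (a b y w : A) (u v : dual A ⊗ A).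
Let H := drinfeld_double A.
Let coassoc U := coassociative_sum (@comul_coassoc k A) (U := U).

(** S^-1 reverses products, so the factors coming from y enclose those coming
    from w. *)
Lemma dd_twistM v y w b :
  dd_twist v (y * w) b = \sw_(y1, y23 <- comul y) \sw_(y2, y3 <- comul y23)
    y2 * dd_twist v w (Si y3 * b * y1).
Proof.
rewrite {1}/dd_twist sw_comulM //; apply: eq_tsum => y1 y23.
under eq_tsum => w1 w23 do rewrite sw_comulM //.
rewrite exchange_tsum; apply: eq_tsum => y2 y3.
rewrite /dd_twist mulr_tsumr; apply: eq_tsum => w1 w23.
rewrite mulr_tsumr; apply: eq_tsum => w2 w3.
by rewrite antipodeVM !mulrA.
Qed.

Lemma sw_comul_antipodeV (U : vectType k) y (F : A -> A -> U) : bilinear F ->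
  \sw_(s1, s2 <- comul (Si y)) F s1 s2
  = \sw_(y1, y2 <- comul y) F (Si y2) (Si y1).
Proof.
move=> bilF; rewrite comul_antipodeV tsum_tsum //.
by apply: eq_tsum => y1 y2; rewrite tsumE.
Qed.

(** Both sides are sums over the five-fold coproduct of y: the left-hand one
    comes bracketed as (y1 y2) (y3 (y4 y5)), because the coproduct of
    S^-1(y'') b y' is taken, and the right-hand one as y1 ((y2 (y3 y4)) y5). *)
Lemma dd_twist_mul v u y b :
  dd_twist (dd_mul v u) y b
  = \sw_(b1, b2 <- comul b) dd_twist u (dd_twist v y b1) b2.
Proof.
transitivity (\sw_(b1, b2 <- comul b) sw_tree (@comul k A)
  (Node (Node Leaf Leaf) (Node Leaf (Node Leaf Leaf))) y
  (fun s => s`_2 * dd_twist u (dd_fun v (Si s`_4 * b1 * s`_0))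
                               (Si s`_3 * b2 * s`_1))).
  rewrite [RHS]exchange_tsum; apply: eq_tsum => y1 y23 /=.
  under [RHS]eq_tsum => b1 b2 do rewrite exchange_tsum.
  rewrite [RHS]exchange_tsum; apply: eq_tsum => y2 y3 /=.
  rewrite dd_fun_mul mulr_tsumr sw_comulM; last by multilin.
  rewrite sw_comulM; last by multilin.
  rewrite sw_comul_antipodeV; last by multilin.
  rewrite exchange_tsum; apply: eq_tsum => b1 b2.
  by rewrite exchange_tsum.
apply: eq_tsum => b1 b2.
rewrite (comul_rebracket
  (t' := Node Leaf (Node (Node Leaf (Node Leaf Leaf)) Leaf)));
  [rewrite /= | by [] | by rewrite /=; multilin].
rewrite (linear_tsum (f := (dd_twist u)^~ b2)) //; apply: eq_tsum => y1 y23.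
rewrite (linear_tsum (f := (dd_twist u)^~ b2)) //; apply: eq_tsum => y2 y3.
by rewrite dd_twistM.
Qed.

Lemma dd_mulA u v u' : dd_mul u (dd_mul v u') = dd_mul (dd_mul u v) u'.
Proof.
apply: (separating_inj (@dd_fun_separating _ A)) => a.
rewrite !dd_fun_mul; under eq_tsum => a1 a2 do rewrite dd_twist_mul.
rewrite -(coassoc (F := fun x y z =>
  dd_twist u' (dd_twist v (dd_fun u x) y) z)); [|by multilin|by multilin].
apply: eq_tsum => a1 a2; rewrite dd_fun_mul.
by rewrite (linear_tsum (f := (dd_twist u')^~ a2)).
Qed.

Lemma counit_antipodeV a : counit (Si a) = counit a.
Proof.
have := sw_antipodeVl (a := a) (f := @counit k A) (@hom_lin _ _ _ _).
rewrite counit1; under eq_tsum => x y do rewrite counitM mulrC.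
rewrite (sw_counitl (f := fun y => counit (Si y))) // => ->.
exact: mulr1.
Qed.

Lemma dd_fun_inr x a : dd_fun (counit ⊗ x) a = (counit a : k) *: x.
Proof. exact: dd_funE. Qed.

Lemma dd_twist_inr x y b :
  dd_twist (counit ⊗ x) y b = (counit b : k) *: (y * x).
Proof.
rewrite /dd_twist; under eq_tsum => y1 y23.
  under eq_tsum => y2 y3.
    rewrite dd_funE !counitM counit_antipodeV -scalerAr -mulrA -scalerA; over.
  rewrite (sw_counitr (f := fun z => (counit b * counit y1 : k) *: (z * x))) //.
  rewrite mulrC -scalerA; over.
by rewrite (sw_counitl (f := fun z => (counit b : k) *: (z * x))).
Qed.

Lemma dd_twist1 v b : dd_twist v 1 b = dd_fun v b.
Proof. by rewrite /dd_twist !sw_comul1 // antipodeV1 !mul1r mulr1. Qed.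

Lemma dd_mul1 u : dd_mul (counit ⊗ 1) u = u.
Proof.
apply: (separating_inj (@dd_fun_separating _ A)) => a.
rewrite dd_fun_mul; under eq_tsum => a1 a2.
  rewrite dd_fun_inr (linear_scale (f := (dd_twist u)^~ a2)) // dd_twist1; over.
by rewrite sw_counitl.
Qed.

Lemma dd_mulr1 u : dd_mul u (counit ⊗ 1) = u.
Proof.
apply: (separating_inj (@dd_fun_separating _ A)) => a.
rewrite dd_fun_mul; under eq_tsum => a1 a2 do rewrite dd_twist_inr mulr1.
by rewrite sw_counitr.
Qed.

Lemma dd_mul_bilinear : bilinear (@dd_mul k A).
Proof.
have sepA := @dd_fun_separating _ A.
split=> [u|v] c x y; apply: (separating_inj sepA) => a.
  have lin_v : linear (fun v => \sw_(a1, a2 <- comul a)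
    dd_twist v (dd_fun u a1) a2) by multilin.
  by rewrite [RHS](proj1 sepA a) !dd_fun_mul lin_v.
have lin_u : linear (fun u => \sw_(a1, a2 <- comul a)
  dd_twist v (dd_fun u a1) a2) by multilin.
by rewrite [RHS](proj1 sepA a) !dd_fun_mul lin_u.
Qed.

Lemma dd_is_algebra : is_algebra H.
Proof.
split; [exact: dd_mul_bilinear | exact: dd_mulA | ].
by move=> u; split; [exact: dd_mul1 | exact: dd_mulr1].
Qed.

End DrinfeldBialgebra.

(** * The coalgebra structure of the Drinfel'd double *)

Section DrinfeldCoalgebra.
Variables (k : fieldType) (A : hopfAlgType k).
Implicit Types (a b y w : A) (u v : dual A ⊗ A).


(** The identification of D(A) ⊗ D(A) with the bilinear maps from A × A to
    A ⊗ A. *)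
Definition dd_fun2 (t : (dual A ⊗ A) ⊗ (dual A ⊗ A)) a b : A ⊗ A :=
  \sw_(u, v <- t) dd_fun u a ⊗ dd_fun v b.

Let sep1 := @dd_fun_separating k A.
Let sep2 := separating_tens sep1 sep1.
Let sep3 := separating_tens sep1 sep2.

Lemma dd_fun2_inj s t : (forall a b, dd_fun2 s a b = dd_fun2 t a b) -> s = t.
Proof.
by move=> eq_st; apply: (separating_inj sep2) => -[a b]; apply: eq_st.
Qed.

Lemma dd_fun2_linear a b : linear (fun t => dd_fun2 t a b).
Proof. by rewrite /dd_fun2; multilin. Qed.

Lemma dd_fun2E u v a b : dd_fun2 (u ⊗ v) a b = dd_fun u a ⊗ dd_fun v b.
Proof. by rewrite /dd_fun2 tsumE. Qed.

(** The product b a is reversed because the coalgebra D(A) is A^* with its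
    opposite coproduct, tensored with A. *)
Lemma dd_fun2_comul u a b : dd_fun2 (dd_comul u) a b = comul (dd_fun u (b * a)).
Proof.
rewrite /dd_comul (linear_tsum (f := fun t => dd_fun2 t a b)); last first.
  exact: dd_fun2_linear.
rewrite /(dd_fun u) hom_tsum; apply: eq_tsum => p x.
rewrite linearZ /= -[in RHS](tsum_id (comul x)) dual_comulE.
rewrite (linear_tsum (f := fun t => dd_fun2 t a b)); last exact: dd_fun2_linear.
rewrite /tsum scaler_suml; apply: eq_bigr => i _.
rewrite scaler_sumr (linear_bigsum (f := fun t => dd_fun2 t a b)); last first.
  exact: dd_fun2_linear.
apply: eq_bigr => j _; rewrite dd_fun2E !dd_funE tensZl tensZr scalerA.
by rewrite mulrC.
Qed.

Lemma sw_dd_comul (U : vectType k) u a b (F : A -> A -> U) : bilinear F ->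
  \sw_(u1, u2 <- dd_comul u) F (dd_fun u1 a) (dd_fun u2 b)
  = \sw_(x, y <- comul (dd_fun u (b * a))) F x y.
Proof.
move=> bilF; rewrite -dd_fun2_comul /dd_fun2 [RHS]tsum_tsum //.
by apply: eq_tsum => u1 u2; rewrite tsumE.
Qed.

Arguments sw_dd_comul {U u a b F}.

Lemma dd_comul_linear : linear (@dd_comul k A).
Proof.
move=> c u v; apply: dd_fun2_inj => a b.
rewrite dd_fun2_linear !dd_fun2_comul.
have lin_u : linear (fun u => comul (dd_fun u (b * a))) by multilin.
exact: lin_u.
Qed.

Lemma dd_coassociative : coassociative (@dd_comul k A).
Proof.
move=> u; apply: (separating_inj sep3) => -[a [b c]] /=.
rewrite tsum_tsum //.
under eq_tsum => u1 u2.
  rewrite tsum_tsum //.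
  under eq_tsum => u11 u12 do rewrite tsumE // tsumE //.
  rewrite (sw_dd_comul (F := fun x y => x ⊗ (y ⊗ dd_fun u2 c))) //.
  over.
rewrite (sw_dd_comul
  (F := fun z w => \sw_(x, y <- comul z) x ⊗ (y ⊗ w))) // comul_coassoc.
rewrite tsum_tsum //.
under [RHS]eq_tsum => u1 u2 do
  rewrite tsumE // -/(dd_fun2 _ _ _) dd_fun2_comul.
rewrite (sw_dd_comul (F := fun x y => x ⊗ comul y)) //.
by rewrite mulrA.
Qed.

Lemma dd_counitE u : dd_counit A u = counit (dd_fun u 1).
Proof.
rewrite linfunE /dd_fun ?hom_tsum; last by multilin.
by apply: eq_tsum => p x; rewrite linearZ.
Qed.

Lemma dd_counital : counital (@dd_comul k A) (dd_counit A).
Proof.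
move=> u; split; apply: (separating_inj sep1) => a;
  rewrite (linear_tsum (f := (@dd_fun k A)^~ a)) //; under eq_tsum => u1 u2 do
    rewrite (linear_scale (f := (@dd_fun k A)^~ a)) // dd_counitE.
  rewrite (sw_dd_comul (F := fun x y : A => (counit x : k) *: y)) //.
  by rewrite sw_counitl ?mulr1 //.
rewrite (sw_dd_comul (F := fun x y : A => (counit y : k) *: x)) //.
by rewrite sw_counitr ?mul1r //.
Qed.

Lemma dd_counitM u v :
  dd_counit A (dd_mul u v) = (dd_counit A u : k) * dd_counit A v.
Proof.
rewrite !dd_counitE dd_fun_mul sw_comul1; last by multilin.
rewrite /dd_twist hom_tsum.
under eq_tsum => y1 y23.
  rewrite hom_tsum; under eq_tsum => y2 y3 do rewrite counitM mulr1.
  rewrite (sw_counitl (f := fun z => counit (dd_fun v (Si z * y1)))) //.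
  over.
by rewrite (sw_antipodeVl (f := fun z => counit (dd_fun v z))).
Qed.

Lemma dd_counit1 : dd_counit A (counit ⊗ 1) = 1.
Proof. by rewrite dd_counitE dd_fun_inr counit1 scale1r counit1. Qed.

Lemma dd_comul1 :
  dd_comul ((counit : dual A) ⊗ (1 : A)) = (counit ⊗ 1) ⊗ (counit ⊗ 1).
Proof.
apply: dd_fun2_inj => a b; rewrite dd_fun2_comul dd_fun2E !dd_fun_inr.
rewrite counitM linearZ /= tensZl tensZr scalerA mulrC; congr (_ *: _).
by rewrite -[LHS]tsum_id sw_comul1.
Qed.

End DrinfeldCoalgebra.
Arguments sw_dd_comul {k A U u a b F}.

(** * Compatibility of product and coproduct *)

Section DrinfeldIsBialgebra.
Variables (k : fieldType) (A : hopfAlgType k).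
Implicit Types (a b y w : A) (u v : dual A ⊗ A).
Let H := drinfeld_double A.


Lemma comul_mul_sum a b :
  comul (a * b) = \sw_(a1, a2 <- comul a) \sw_(b1, b2 <- comul b)
    (a1 * b1) ⊗ (a2 * b2).
Proof. by rewrite -[LHS]tsum_id sw_comulM. Qed.

Lemma dd_twist2_comul v s a t b :
  \sw_(v1, v2 <- dd_comul v) dd_twist v1 s a ⊗ dd_twist v2 t b
  = \sw_(s1, s23 <- comul s) \sw_(s2, s3 <- comul s23)
    \sw_(t1, t23 <- comul t) \sw_(t2, t3 <- comul t23)
    \sw_(x, y <- comul (dd_fun v ((Si t3 * b * t1) * (Si s3 * a * s1))))
      (s2 * x) ⊗ (t2 * y).
Proof.
under eq_tsum => v1 v2 do rewrite {1}/dd_twist tens_tsuml.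
rewrite exchange_tsum; apply: eq_tsum => s1 s23.
under eq_tsum => v1 v2 do rewrite tens_tsuml.
rewrite exchange_tsum; apply: eq_tsum => s2 s3.
under eq_tsum => v1 v2 do rewrite /dd_twist tens_tsumr.
rewrite exchange_tsum; apply: eq_tsum => t1 t23.
under eq_tsum => v1 v2 do rewrite tens_tsumr.
rewrite exchange_tsum; apply: eq_tsum => t2 t3.
by rewrite (sw_dd_comul (F := fun x y => (s2 * x) ⊗ (t2 * y))).
Qed.

(** On the left-hand side y is split into six factors, and v is applied to
    S^-1(y6) b y4 S^-1(y3) a y1; once y4 S^-1(y3) is cancelled, what remains is
    the coproduct of y2 v(S^-1(y3) b a y1). *)
Lemma dd_twist_comul v y a b :
  \sw_(s, t <- comul y) \sw_(v1, v2 <- dd_comul v)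
    dd_twist v1 s a ⊗ dd_twist v2 t b
  = comul (dd_twist v y (b * a)).
Proof.
pose K z0 z1 z2 z3 := \sw_(x, y <- comul (dd_fun v (Si z3 * (b * a) * z0)))
  (z1 * x) ⊗ (z2 * y).
transitivity (sw_tree (@comul k A)
   (Node (Node Leaf (Node Leaf Leaf)) (Node Leaf (Node Leaf Leaf))) y
   (fun z => \sw_(x, y <- comul (dd_fun v
        ((Si z`_5 * b * z`_3) * (Si z`_2 * a * z`_0))))
      (z`_1 * x) ⊗ (z`_4 * y))).
  by apply: eq_tsum => s t; rewrite dd_twist2_comul.
rewrite (comul_rebracket (t' :=
  Node Leaf (Node Leaf (Node (Node Leaf Leaf) (Node Leaf Leaf))))) //=.
transitivity (sw_tree (@comul k A) (Node Leaf (Node Leaf (Node Leaf Leaf))) y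
   (fun z => K z`_0 z`_1 z`_2 z`_3)).
  apply: eq_tsum => z0 z /=; apply: eq_tsum => z1 {}z.
  under eq_tsum => p q.
    under eq_tsum => z2 z3.
      under eq_tsum => z4 z5 do
        (* isolate z3 * S^-1(z2) *)
        rewrite !mulrA -(mulrA _ z3).
      over.
    rewrite (sw_antipodeVr (f := fun w => \sw_(z4, z5 <- comul q)
      \sw_(x, y <- comul (dd_fun v (Si z5 * b * w * a * z0)))
        (z1 * x) ⊗ (z4 * y))) //.
    over.
  rewrite sw_counitl //; apply: eq_tsum => z4 z5.
  by rewrite /K mulr1 !mulrA.
rewrite (comul_rebracket (t' := Node Leaf (Node (Node Leaf Leaf) Leaf))) //=;
  last by rewrite /K; multilin.
rewrite hom_tsum; apply: eq_tsum => y1 y23.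
rewrite hom_tsum; apply: eq_tsum => y2 y3.
by rewrite comul_mul_sum.
Qed.

Lemma dd_comulM u v :
  dd_comul (dd_mul u v) = @tmul k H (dd_comul u) (dd_comul v).
Proof.
apply: dd_fun2_inj => a b.
rewrite dd_fun2_comul dd_fun_mul hom_tsum sw_comulM; last by multilin.
under eq_tsum => b1 b2 do under eq_tsum => a1 a2 do rewrite -dd_twist_comul.
transitivity (\sw_(u1, u2 <- dd_comul u) \sw_(v1, v2 <- dd_comul v)
  \sw_(b1, b2 <- comul b) \sw_(a1, a2 <- comul a)
    dd_twist v1 (dd_fun u1 a1) a2 ⊗ dd_twist v2 (dd_fun u2 b1) b2);
  last first.
  apply/esym; apply: (etrans (@sw_tmul k H _ _ _
    (fun u v => dd_fun u a ⊗ dd_fun v b) _)) => //.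
  apply: eq_tsum => u1 u2; apply: eq_tsum => v1 v2.
  rewrite !dd_fun_mul tens_tsumr.
  by apply: eq_tsum => b1 b2; rewrite tens_tsuml.
under [RHS]eq_tsum => u1 u2 do rewrite exchange_tsum.
rewrite [RHS]exchange_tsum; apply: eq_tsum => b1 b2.
under [RHS]eq_tsum => u1 u2 do rewrite exchange_tsum.
rewrite [RHS]exchange_tsum; apply: eq_tsum => a1 a2.
by rewrite [RHS](sw_dd_comul (F := fun s t => \sw_(v1, v2 <- dd_comul v)
  dd_twist v1 s a2 ⊗ dd_twist v2 t b2)).
Qed.

Lemma dd_is_bialgebra : is_bialgebra H.
Proof.
split; first exact: dd_is_algebra.
- split; [exact: dd_comul_linear | exact: dd_coassociative |].
  exact: dd_counital.
- by split; [exact: dd_comulM | exact: dd_comul1].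
- by split; [exact: dd_counitM | exact: dd_counit1].
Qed.

End DrinfeldIsBialgebra.

(** * The R-matrix *)

Section DrinfeldQuasitriangular.
Variables (k : fieldType) (A : hopfAlgType k).
Implicit Types (a b y w : A) (u v : dual A ⊗ A) (p q : dual A).
Let H := drinfeld_double A.

Ltac multilin_fact ::=
  lazymatch goal with
  | |- GRing.linear_for _ (fun x => dd_fun (@?u x) _) =>
      tryif is_constant u then apply: (lin_op_r (@dd_fun_bilinear _ _))
      else apply: (lin_op_l (@dd_fun_bilinear _ _))
  | |- GRing.linear_for _ (fun x => dd_twist (@?v x) (@?y x) _) =>
      tryif is_constant v then
        tryif is_constant y then apply: (lin_op_r (dd_twist_bilinear _))
        else apply: (lin_op_l (dd_twist_bilinear _))
      else apply: lin_dd_twist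
  (* this also covers amul, which unfolds to dd_mul *)
  | |- _ => first [ apply: (lin_op_l (@dd_mul_bilinear _ _))
                  | apply: (lin_op_r (@dd_mul_bilinear _ _)) ]
  end.

Let sep1 := @dd_fun_separating k A.
Let sep2 := separating_tens sep1 sep1.
Let sep3 := separating_tens sep1 sep2.

(** The R-matrix is the case g = id, its inverse the case g = S: products of
    such elements are governed by convolution products of maps
    ([tmul_dd_R_of]). *)
Definition dd_R_of (g : A -> A) : (dual A ⊗ A) ⊗ (dual A ⊗ A) :=
  \sum_i (counit ⊗ g (vbas i)) ⊗ (dbas i ⊗ 1).

Lemma sum_dbas (U : vectType k) (f : A -> U) b :
  linear f -> \sum_i (dbas i b : k) *: f (vbas i) = f b.
Proof.
move=> lin_f; rewrite [in RHS](dbas_sum b) (linear_bigsum _ lin_f).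
by apply: eq_bigr => i _; rewrite linear_scale.
Qed.

Lemma sw_dd_R (U : vectType k) g (F : dual A ⊗ A -> dual A ⊗ A -> U) :
  bilinear F ->
  \sw_(u, v <- dd_R_of g) F u v
  = \sum_i F (counit ⊗ g (vbas i)) (dbas i ⊗ 1).
Proof.
move=> bilF; rewrite (linear_bigsum _ (tsum_linear bilF)).
by apply: eq_bigr => i _; rewrite tsumE.
Qed.

Lemma dd_fun_mul_inr (x : A) v a :
  dd_fun (dd_mul (counit ⊗ x) v) a = dd_twist v x a.
Proof.
rewrite dd_fun_mul; under eq_tsum => a1 a2 do
  rewrite dd_fun_inr (linear_scale (f := (dd_twist v)^~ a2)) //.
by rewrite (sw_counitl (f := dd_twist v x)).
Qed.

Lemma dd_fun_mulr_inr u (x : A) a :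
  dd_fun (dd_mul u (counit ⊗ x)) a = dd_fun u a * x.
Proof.
rewrite dd_fun_mul; under eq_tsum => a1 a2 do rewrite dd_twist_inr.
by rewrite (sw_counitr (f := fun z => dd_fun u z * x)).
Qed.

Lemma dd_fun_mul_inl p v b :
  dd_fun (dd_mul (p ⊗ 1) v) b
  = \sw_(b1, b2 <- comul b) (p b1 : k) *: dd_fun v b2.
Proof.
rewrite dd_fun_mul; apply: eq_tsum => b1 b2.
by rewrite dd_funE (linear_scale (f := (dd_twist v)^~ b2)) // dd_twist1.
Qed.

Lemma dd_fun_inl_mul p q b :
  dd_fun (dd_mul (p ⊗ 1) (q ⊗ 1)) b = (dual_conv p q b : k)%:A.
Proof.
rewrite dd_fun_mul_inl scale_dual_conv.
by apply: eq_tsum => b1 b2; rewrite dd_funE.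
Qed.

(** Contracting products of dual basis vectors with the basis is taking a
    coproduct, which is what [dd_R_comull] rests on. *)
Lemma sum_dbas_conv (U : vectType k) (f : A -> A -> U) b :
  bilinear f ->
  \sum_i \sum_j (dual_conv (dbas i) (dbas j) b : k) *: f (vbas i) (vbas j)
  = \sw_(b1, b2 <- comul b) f b1 b2.
Proof.
move=> [linr linl].
under eq_bigr => i _ do under eq_bigr => j _ do rewrite scale_dual_conv.
under eq_bigr => i _ do rewrite exchange_big.
rewrite exchange_big; apply: eq_bigr => m _ /=.
rewrite -(sum_dbas _ (linl _)); apply: eq_bigr => i _.
by rewrite -(sum_dbas _ (linr _)) scaler_sumr.
Qed.

Lemma dd_fun_mulr_inl u p b :
  dd_fun (dd_mul u (p ⊗ 1)) b
  = \sw_(b1, b2 <- comul b) \sw_(y1, y23 <- comul (dd_fun u b1))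
    \sw_(y2, y3 <- comul y23) (p (Si y3 * b2 * y1) : k) *: y2.
Proof.
rewrite dd_fun_mul; apply: eq_tsum => b1 b2; apply: eq_tsum => y1 y23.
by apply: eq_tsum => y2 y3; rewrite dd_funE -scalerAr mulr1.
Qed.

Lemma dd_fun2_tmul_R_of g (t : H ⊗ H) a b : linear g ->
  dd_fun2 (@tmul k H (dd_R_of g) t) a b
  = \sw_(b1, b2 <- comul b) \sw_(v1, v2 <- t)
      dd_twist v1 (g b1) a ⊗ dd_fun v2 b2.
Proof.
move=> lin_g.
rewrite [LHS](@sw_tmul k H _ _ _ (fun u v => dd_fun u a ⊗ dd_fun v b)) //.
rewrite [RHS]exchange_tsum exchange_tsum; apply: eq_tsum => v1 v2.
rewrite sw_dd_R //.
under eq_bigr => i _.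
  rewrite dd_fun_mul_inr dd_fun_mul_inl tens_tsumr.
  under eq_tsum => b1 b2 do rewrite tensZr.
  over.
rewrite exchange_big; apply: eq_bigr => m _ /=.
by rewrite (sum_dbas (f := fun z => dd_twist v1 (g z) a ⊗ _)).
Qed.

Lemma tmul_dd_R_of g h : linear g -> linear h ->
  (forall a, \sw_(a1, a2 <- comul a) g a1 * h a2 = (counit a : k)%:A) ->
  @tmul k H (dd_R_of g) (dd_R_of h) = aone H ⊗ aone H.
Proof.
move=> lin_g lin_h conv_gh; apply: dd_fun2_inj => a b.
rewrite dd_fun2_tmul_R_of //; under eq_tsum => b1 b2.
  rewrite sw_dd_R //; under eq_bigr => i _ do
    rewrite dd_twist_inr dd_funE tensZr tensZl.
  rewrite (sum_dbas (f := fun z => (counit a : k) *: ((g b1 * h z) ⊗ 1))) //.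
  over.
rewrite -scaler_tsum -tens_tsuml conv_gh dd_fun2E !dd_fun_inr.
by rewrite !(tensZl, tensZr).
Qed.

Definition dd_Rinv : H ⊗ H := dd_R_of antipode.

Lemma dd_RE : dd_R A = dd_R_of id.
Proof. by []. Qed.

Lemma dd_R_inverse : @tens_inverse k H (dd_R A) dd_Rinv.
Proof.
rewrite dd_RE; split; apply: tmul_dd_R_of => //.
- by move=> a; rewrite (proj2 (antipode_axiom a)).
- by move=> a; rewrite (proj1 (antipode_axiom a)).
Qed.

(** This is Δ^op(u) R as a map from A × A to A ⊗ A.  With y ⊗ x = Δ(u(a b1)) it
    is the sum of x S^-1(y3) b2 y1 ⊗ y2, in which x S^-1(y3) cancels.  It serves
    both in [dd_R_comul] and for the product of the twisted dual
    ([dd_identM]). *)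
Lemma dd_fun2_comul_op_R u a b :
  \sw_(u1, u2 <- dd_comul u) \sw_(r1, r2 <- dd_R A)
    dd_fun (dd_mul u2 r1) a ⊗ dd_fun (dd_mul u1 r2) b
  = \sw_(b1, b2 <- comul b) \sw_(y, z <- comul (dd_fun u (a * b1)))
      (b2 * y) ⊗ z.
Proof.
apply/esym.
transitivity (\sw_(u1, u2 <- dd_comul u) \sw_(b1, b2 <- comul b)
    \sw_(y1, y23 <- comul (dd_fun u1 b1)) \sw_(y2, y3 <- comul y23)
    (dd_fun u2 a * (Si y3 * b2 * y1)) ⊗ y2); last first.
  apply: eq_tsum => u1 u2; rewrite dd_RE sw_dd_R; last by multilin.
  under [RHS]eq_bigr => i _.
    rewrite dd_fun_mulr_inr dd_fun_mulr_inl tens_tsumr; over.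
  rewrite [RHS]exchange_big; apply: eq_bigr => m _ /=.
  under [RHS]eq_bigr => i _ do rewrite tens_tsumr.
  rewrite [RHS]exchange_big; apply: eq_bigr => n _ /=.
  under [RHS]eq_bigr => i _ do rewrite tens_tsumr.
  rewrite [RHS]exchange_big; apply: eq_bigr => l _ /=.
  under [RHS]eq_bigr => i _ do rewrite tensZr.
  by rewrite (sum_dbas (f := fun z => (dd_fun u2 a * z) ⊗ _)).
rewrite [RHS]exchange_tsum; apply: eq_tsum => b1 b2.
rewrite (sw_dd_comul (F := fun y x => \sw_(y1, y23 <- comul y)
  \sw_(y2, y3 <- comul y23) (x * (Si y3 * b2 * y1)) ⊗ y2)) //.
transitivity (sw_tree (@comul k A) (Node (Node Leaf (Node Leaf Leaf)) Leaf)
  (dd_fun u (a * b1))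
  (fun s => (s`_3 * (Si s`_2 * b2 * s`_0)) ⊗ s`_1)) => //.
rewrite (comul_rebracket (t' := Node Leaf (Node Leaf (Node Leaf Leaf)))) //=.
apply: eq_tsum => y1 y; under [RHS]eq_tsum => y2 y3.
  under eq_tsum => z3 z4 do rewrite !mulrA.
  rewrite (sw_antipodeVr (f := fun w => (w * b2 * y1) ⊗ y2)) //.
  over.
by rewrite sw_counitr // mul1r.
Qed.

(** R Δ(u) maps (a, b) to the sum of (b2 ⊗ 1) Δ(u(b4 S^-1(b3) a b1)), where
    b4 S^-1(b3) cancels; the result agrees with [dd_fun2_comul_op_R]. *)
Lemma dd_R_comul u :
  @tmul k H (dd_R A) (dd_comul u)
  = @tmul k H (\sw_(u1, u2 <- dd_comul u) u2 ⊗ u1) (dd_R A).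
Proof.
apply: dd_fun2_inj => a b.
transitivity (\sw_(b1, b2 <- comul b) \sw_(y, z <- comul (dd_fun u (a * b1)))
  (b2 * y) ⊗ z).
  rewrite dd_RE dd_fun2_tmul_R_of //.
  transitivity (\sw_(b1, b2 <- comul b) \sw_(y1, y23 <- comul b1)
    \sw_(y2, y3 <- comul y23)
    \sw_(y, z <- comul (dd_fun u (b2 * (Si y3 * a * y1)))) (y2 * y) ⊗ z).
    apply: eq_tsum => b1 b2; rewrite /dd_twist.
    under eq_tsum => v1 v2 do rewrite tens_tsuml.
    rewrite exchange_tsum; apply: eq_tsum => y1 y23.
    under eq_tsum => v1 v2 do rewrite tens_tsuml.
    rewrite exchange_tsum; apply: eq_tsum => y2 y3.
    by rewrite (sw_dd_comul (F := fun y z => (y2 * y) ⊗ z)).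
  transitivity (sw_tree (@comul k A) (Node (Node Leaf (Node Leaf Leaf)) Leaf) b
    (fun s => \sw_(y, z <- comul (dd_fun u (s`_3 * (Si s`_2 * a * s`_0))))
       (s`_1 * y) ⊗ z)) => //.
  rewrite (comul_rebracket (t' := Node Leaf (Node Leaf (Node Leaf Leaf)))) //=.
  apply: eq_tsum => y1 y; under eq_tsum => y2 y3.
    under eq_tsum => z3 z4 do rewrite !mulrA.
    rewrite (sw_antipodeVr (f := fun w =>
      \sw_(y, z <- comul (dd_fun u (w * a * y1))) (y2 * y) ⊗ z)) //.
    over.
  by rewrite sw_counitr // mul1r.
rewrite -dd_fun2_comul_op_R; apply/esym.
apply: (etrans (@sw_tmul k H _ _ _
  (fun u v => dd_fun u a ⊗ dd_fun v b) _)).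
  by multilin.
rewrite tsum_tsum; last by multilin.
by apply: eq_tsum => u1 u2; rewrite tsumE.
Qed.

Lemma dd_R_comull :
  \sw_(r1, r2 <- dd_R A) \sw_(s, t <- dd_comul r1) s ⊗ (t ⊗ r2)
  = \sw_(r1, r2 <- dd_R A) \sw_(q1, q2 <- dd_R A) r1 ⊗ (q1 ⊗ dd_mul r2 q2).
Proof.
apply: (separating_inj sep3) => -[a [b c]] /=.
transitivity ((counit a * counit b : k) *:
  \sw_(c1, c2 <- comul c) c1 ⊗ (c2 ⊗ (1 : A))).
  rewrite dd_RE tsum_tsum //; under eq_tsum => r1 r2.
    rewrite tsum_tsum //; under eq_tsum => s t do rewrite tsumE // tsumE //.
    rewrite (sw_dd_comul (F := fun x y => x ⊗ (y ⊗ dd_fun r2 c))) //; over.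
  rewrite sw_dd_R //; under eq_bigr => i _.
    rewrite dd_fun_inr dd_funE; under eq_tsum => x y do rewrite !tensZr.
    rewrite -scaler_tsum; over.
  rewrite (sum_dbas (f := fun z =>
    \sw_(x, y <- comul ((counit (b * a) : k) *: z)) x ⊗ (y ⊗ 1))) //.
  rewrite linearZ /= counitM [in LHS]mulrC.
  exact: linear_scale (tsum_linear _).
rewrite dd_RE tsum_tsum //; under [RHS]eq_tsum => r1 r2.
  rewrite tsum_tsum //; under eq_tsum => q1 q2 do rewrite tsumE // tsumE //.
  rewrite sw_dd_R //; over.
rewrite sw_dd_R //.
under [RHS]eq_bigr => i _ do under eq_bigr => j _ do
  rewrite !dd_fun_inr dd_fun_inl_mul !(tensZl, tensZr) !scalerA mulrC -scalerA.
rewrite (sum_dbas_conv (f := fun x y =>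
  (counit a * counit b : k) *: (x ⊗ (y ⊗ 1)))) //.
by rewrite scaler_tsum.
Qed.

Lemma dd_R_comulr :
  \sw_(r1, r2 <- dd_R A) r1 ⊗ dd_comul r2
  = \sw_(r1, r2 <- dd_R A) \sw_(q1, q2 <- dd_R A) dd_mul r1 q1 ⊗ (q2 ⊗ r2).
Proof.
apply: (separating_inj sep3) => -[a [b c]] /=.
transitivity ((counit a : k) *: ((c * b) ⊗ (1 ⊗ 1 : (A ⊗ A)%type))).
  rewrite dd_RE tsum_tsum //; under eq_tsum => r1 r2 do
    rewrite tsumE // -/(dd_fun2 _ _ _) dd_fun2_comul.
  rewrite sw_dd_R //; under eq_bigr => i _.
    rewrite dd_fun_inr dd_funE linearZ /= tensZr -[comul 1]tsum_id sw_comul1 //.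
    rewrite tensZl; over.
  by rewrite (sum_dbas (f := fun z => (counit a : k) *: (z ⊗ (1 ⊗ 1)))).
rewrite dd_RE tsum_tsum //; under [RHS]eq_tsum => r1 r2.
  rewrite tsum_tsum //; under eq_tsum => q1 q2 do rewrite tsumE // tsumE //.
  rewrite sw_dd_R //; over.
rewrite sw_dd_R //.
under [RHS]eq_bigr => i _.
  under eq_bigr => j _ do
    rewrite dd_fun_mul_inr dd_twist_inr !dd_funE !(tensZl, tensZr) scalerA
            scalerA mulrC -scalerA (mulrC (counit a : k)) -scalerA.
  rewrite -scaler_sumr (sum_dbas (f := fun z =>
    (counit a : k) *: ((vbas i * z) ⊗ (1 ⊗ 1)))) //.
  over.
by rewrite (sum_dbas (f := fun z => (counit a : k) *: ((z * b) ⊗ (1 ⊗ 1)))).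
Qed.

Lemma dd_is_quasitriangular : is_quasitriangular (dd_R A).
Proof.
split; [exact: dd_is_bialgebra | by exists dd_Rinv; apply: dd_R_inverse | | |].
- exact: dd_R_comul.
- exact: dd_R_comull.
- exact: dd_R_comulr.
Qed.

End DrinfeldQuasitriangular.

(** * The product of the twisted dual *)

Section DualProduct.
Variables (k : fieldType) (H : bialgData k).
Hypothesis bialg_H : is_bialgebra H.

Let alg_H : is_algebra H. Proof. by case: bialg_H. Qed.
Let lin_D : linear (@bcomul k H). Proof. by case: bialg_H => _ []. Qed.

Let mul_bil := amul_bilinear alg_H.
Let lin_D_comp (X : vectType k) (g : X -> H) :
  linear g -> linear (fun x => bcomul (g x)).
Proof. exact: lin_comp. Qed.
Ltac multilin_fact ::=
  first [ apply: (lin_op_l mul_bil) | apply: (lin_op_r mul_bil)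
        | apply: lin_D_comp ].

Lemma dual_R_mulE (R : H ⊗ H) (f g : dual H) h :
  amul (f : dual_R R) (g : dual_R R) h
  = \sw_(r1, r2 <- R) \sw_(h1, h2 <- bcomul h)
      (g (amul h1 r2) * f (amul h2 r1) : k^o).
Proof.
rewrite /= sum_lfunE; apply: eq_bigr => i _.
rewrite linfunE //; apply: eq_tsum => h1 h2.
by rewrite !(lregE alg_H).
Qed.

End DualProduct.

(** * The Heisenberg double *)

Section HeisenbergDouble.
Variables (k : fieldType) (A : hopfAlgType k).
Implicit Types (a b y : A) (p q : dual A) (h : dual A ⊗ A) (s t : A ⊗ dual A).
Let H := drinfeld_double A.
Let B := heisenberg_double A.
Let coassoc U := coassociative_sum (@comul_coassoc k A) (U := U).

(** The identification of A # A^* with the endomorphisms of A. *)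
Definition heis_fun t y : A := \sw_(a, p <- t) (p y : k) *: a.

Lemma heis_fun_bilinear : bilinear heis_fun.
Proof. by rewrite /heis_fun; split=> [t|y]; multilin. Qed.

Ltac multilin_fact ::=
  first [ apply: (lin_op_l heis_fun_bilinear)
        | apply: (lin_op_r heis_fun_bilinear)
        | apply: (lin_op_l (@dd_fun_bilinear _ _))
        | apply: (lin_op_r (@dd_fun_bilinear _ _)) ].

Lemma heis_funE a p y : heis_fun (a ⊗ p) y = (p y : k) *: a.
Proof. by rewrite /heis_fun tsumE. Qed.

Lemma heis_fun_separating : separating (fun y t => heis_fun t y).
Proof.
split=> [y|]; first by multilin.
exists 'I_(\dim {:A}), (@vbas k A), (fun i x => x ⊗ dbas i).
split=> [i|t]; first by multilin.
rewrite /heis_fun; under eq_bigr => i _ do rewrite tens_tsuml.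
rewrite [RHS]exchange_big -[LHS]tsum_id; apply: eq_bigr => m _ /=.
move: (vbas m) (_ (dbas m)) => a p.
rewrite {1}[p]dual_sum (linear_bigsum (f := fun q => a ⊗ q)) //.
by apply: eq_bigr => i _; rewrite tensZl tensZr.
Qed.

(** For s = a # p and t = a' # p', with c = t(y2), the parts p1 and p2 of the
    coproduct of p are evaluated at c2 and y1, and recombine to p(c2 y1). *)
Lemma heis_fun_mul s t y :
  heis_fun (heis_mul s t) y
  = \sw_(y1, y2 <- comul y) \sw_(c1, c2 <- comul (heis_fun t y2))
      heis_fun s (c2 * y1) * c1.
Proof.
under [RHS]eq_tsum => y1 y2.
  rewrite /(heis_fun t) hom_tsum tsum_tsum //; under eq_tsum => a' p'.
    rewrite homZ tsumZ //; under eq_tsum => c1 c2.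
      rewrite /heis_fun mulr_tsuml; over.
    rewrite exchange_tsum scaler_tsum.
    over.
  rewrite exchange_tsum; over.
rewrite [RHS]exchange_tsum /heis_mul (linear_tsum (f := heis_fun^~ y)) //.
apply: eq_tsum => a p.
rewrite [RHS]exchange_tsum (linear_tsum (f := heis_fun^~ y)) //.
apply: eq_tsum => a' p'; rewrite (linear_tsum (f := heis_fun^~ y)) //.
rewrite /dual_act; under eq_tsum => p1 p2.
  rewrite heis_funE scale_dual_conv; under eq_tsum => y1 y2.
    rewrite mulr_tsumr 2!scaler_tsum; under eq_tsum => c1 c2.
      rewrite -scalerAr !scalerA mulrC mulrCA mulrA -scalerA.
      rewrite (mulrC (p2 y1 : k)).
      over.
    over.
  over.
rewrite exchange_tsum; apply: eq_tsum => y1 y2.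
rewrite scaler_tsum exchange_tsum; apply: eq_tsum => c1 c2.
rewrite -(@scaler_tsuml _ _ _ _ _ (fun p1 p2 : dual A => p1 c2 * p2 y1)).
by rewrite -dual_comulE -scalerAl scalerA mulrC -scalerA.
Qed.

Lemma heis_mul_bilinear : bilinear (@heis_mul k A).
Proof.
have sepA := heis_fun_separating.
split=> [s|t] c x y; apply: (separating_inj sepA) => a.
  have lin_t : linear (fun t => \sw_(y1, y2 <- comul a)
    \sw_(c1, c2 <- comul (heis_fun t y2)) heis_fun s (c2 * y1) * c1).
    by multilin.
  by rewrite [RHS](proj1 sepA a) !heis_fun_mul lin_t.
have lin_s : linear (fun s => \sw_(y1, y2 <- comul a)
    \sw_(c1, c2 <- comul (heis_fun t y2)) heis_fun s (c2 * y1) * c1).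
    by multilin.
rewrite [RHS](proj1 sepA a) [LHS]heis_fun_mul [LHS]lin_s.
by congr (_ *: _ + _); apply/esym; apply: heis_fun_mul.
Qed.

(** Both sides are the sum of r(b2 c2 y1) b1 c1, where b = s(c3 y2) and
    c = t(y3). *)
Lemma heis_mulA r s t :
  heis_mul r (heis_mul s t) = heis_mul (heis_mul r s) t.
Proof.
apply: (separating_inj heis_fun_separating) => y.
pose F y1 y2 c1 c2 c3 := \sw_(b1, b2 <- comul (heis_fun s (c3 * y2)))
  heis_fun r (b2 * (c2 * y1)) * (b1 * c1).
transitivity (\sw_(y1, y23 <- comul y) \sw_(y2, y3 <- comul y23)
  \sw_(c1, c23 <- comul (heis_fun t y3)) \sw_(c2, c3 <- comul c23)
  F y1 y2 c1 c2 c3).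
  rewrite heis_fun_mul; apply: eq_tsum => y1 y23.
  rewrite heis_fun_mul hom_tsum tsum_tsum //; apply: eq_tsum => y2 y3.
  rewrite hom_tsum tsum_tsum //.
  rewrite -(coassoc (F := fun c1 c2 c3 => F y1 y2 c1 c2 c3)); last 2 first.
  - by rewrite /F; multilin.
  - by rewrite /F; multilin.
  apply: eq_tsum => c1 c2; rewrite sw_comulM // /F exchange_tsum.
  by apply: eq_tsum => c3 c4; apply: eq_tsum => b1 b2; rewrite !mulrA.
rewrite -(coassoc (F := fun y1 y2 y3 => \sw_(c1, c23 <- comul (heis_fun t y3))
  \sw_(c2, c3 <- comul c23) F y1 y2 c1 c2 c3)); last 2 first.
- by rewrite /F; multilin.
- by rewrite /F; multilin.
rewrite heis_fun_mul; apply: eq_tsum => y1 y3.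
rewrite exchange_tsum; apply: eq_tsum => c1 c23.
rewrite heis_fun_mul sw_comulM // mulr_tsuml exchange_tsum.
apply: eq_tsum => c2 c3; rewrite mulr_tsuml; apply: eq_tsum => y11 y12.
by rewrite /F mulr_tsuml; apply: eq_tsum => b1 b2; rewrite !mulrA.
Qed.

Lemma heis_fun1 y : heis_fun (1 ⊗ counit) y = (counit y : k)%:A.
Proof. exact: heis_funE. Qed.

Lemma heis_is_algebra : is_algebra B.
Proof.
split=> [||t]; [exact: heis_mul_bilinear | exact: heis_mulA |].
split; apply: (separating_inj heis_fun_separating) => y; rewrite heis_fun_mul.
  under eq_tsum => y1 y2.
    under eq_tsum => c1 c2 do
      rewrite heis_fun1 counitM -scalerAl mul1r mulrC -scalerA.
    rewrite -scaler_tsum sw_counitr //; over.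
  by rewrite sw_counitl.
under eq_tsum => y1 y2.
  rewrite heis_fun1 homZ tsumZ // sw_comul1 // mul1r mulr1; over.
by rewrite sw_counitr.
Qed.

End HeisenbergDouble.

(** * The twisted dual of D(A) is the Heisenberg double *)

Section Identification.
Variables (k : fieldType) (A : hopfAlgType k).
Implicit Types (a b y : A) (p q : dual A) (h : dual A ⊗ A) (s t : A ⊗ dual A).
Let H := drinfeld_double A.
Let B := heisenberg_double A.

Ltac multilin_fact ::=
  first [ apply: (lin_op_l (@dd_fun_bilinear _ _))
        | apply: (lin_op_r (@dd_fun_bilinear _ _)) ].

Lemma dd_ident_sum t h : dd_ident A t h = \sw_(a, f <- t) f (dd_fun h a).
Proof.
rewrite -{1}[t]tsum_id hom_tsum sum_lfunE; apply: eq_bigr => m _.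
rewrite -{1}[h]tsum_id hom_tsum /dd_fun hom_tsum; apply: eq_tsum => p x.
by rewrite homZ; apply: dd_identE.
Qed.

Definition dd_ident_inv (phi : dual H) : B :=
  \sum_i \sum_j (phi (dbas i ⊗ vbas j) : k) *: (vbas i ⊗ dbas j).

Lemma dd_ident_invK : cancel dd_ident_inv (dd_ident A).
Proof.
move=> phi; apply/lfunP => h; rewrite -[h]tsum_id !hom_tsum.
apply: eq_tsum => p x; rewrite /dd_ident_inv hom_bigsum sum_lfunE.
rewrite {2}[p]dual_sum (linear_bigsum (f := fun p => phi (p ⊗ x))); last first.
  by multilin.
apply: eq_bigr => i _; rewrite hom_bigsum sum_lfunE.
rewrite tensZl homZ [in RHS](dbas_sum x).
rewrite (linear_bigsum (f := fun z => phi (dbas i ⊗ z))); last by multilin.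
rewrite scaler_sumr; apply: eq_bigr => j _.
rewrite homZ scale_lfunE [X in _ *: X]dd_identE tensZr homZ.
by rewrite /GRing.scale /= [RHS]mulrA mulrC.
Qed.

Lemma dd_identK : cancel (dd_ident A) dd_ident_inv.
Proof.
move=> t; rewrite /dd_ident_inv.
under eq_bigr => i _.
  under eq_bigr => j _.
    rewrite dd_ident_sum; under eq_tsum => a f do rewrite dd_funE homZ.
    rewrite scaler_tsuml; over.
  rewrite exchange_big; over.
rewrite exchange_big -[RHS]tsum_id; apply: eq_bigr => m _ /=.
move: (vbas m) (_ (dbas m)) => a f.
rewrite {2}[a]dbas_sum (linear_bigsum (f := fun a => a ⊗ f)) //.
apply: eq_bigr => i _; rewrite {2}[f]dual_sum.
rewrite (linear_bigsum (f := fun f => _ ⊗ f)) //; apply: eq_bigr => j _.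
by rewrite tensZl tensZr scalerA.
Qed.

(** On a # q and a' # q', both sides take the value Σ q(b2 y1) q'(y2) at h,
    where b = a' and y = h(a b1). *)
Lemma dd_identM s t :
  dd_ident A (heis_mul s t) =
  amul (dd_ident A s : dual_R (dd_R A)) (dd_ident A t : dual_R (dd_R A)).
Proof.
apply/lfunP => h; rewrite [RHS](dual_R_mulE (dd_is_bialgebra A)).
pose evh (t : A ⊗ dual A) : k^o := dd_ident A t h.
have lin_evh : linear evh by rewrite /evh; multilin.
transitivity (\sw_(a, q <- s) \sw_(a', q' <- t) \sw_(b1, b2 <- comul a')
    \sw_(y, z <- comul (dd_fun h (a * b1))) (q (b2 * y) * q' z : k^o)).
  rewrite -/(evh _) /heis_mul linear_tsum //; apply: eq_tsum => a q.
  rewrite linear_tsum //; apply: eq_tsum => a' q'; rewrite linear_tsum //.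
  transitivity (\sw_(b1, b2 <- comul a') \sw_(q1, q2 <- dual_comul q)
     ((q1 b2 : k) *: dual_conv q2 q' (dd_fun h (a * b1)))).
    rewrite exchange_tsum; apply: eq_tsum => q1 q2.
    rewrite /evh dd_ident_sum tsumE; last by multilin.
    rewrite /dual_act mulr_tsumr (linear_tsum (f := dd_fun h)) //.
    rewrite hom_tsum; apply: eq_tsum => b1 b2.
    by rewrite -scalerAr (linear_scale (f := dd_fun h)) // homZ.
  apply: eq_tsum => b1 b2; under eq_tsum => q1 q2.
    rewrite dual_convE scaler_tsum; over.
  rewrite exchange_tsum; apply: eq_tsum => y z.
  rewrite dual_comulE mulr_tsuml; apply: eq_tsum => q1 q2.
  exact: mulrA.
transitivity (\sw_(a, q <- s) \sw_(a', q' <- t) \sw_(h1, h2 <- dd_comul h)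
    \sw_(r1, r2 <- dd_R A)
    (q' (dd_fun (dd_mul h1 r2) a') * q (dd_fun (dd_mul h2 r1) a) : k^o)).
  apply: eq_tsum => a q; apply: eq_tsum => a' q'.
  pose Q (t : A ⊗ A) : k^o := \sw_(y, z <- t) (q y * q' z : k^o).
  have lin_Q : linear Q by rewrite /Q; multilin.
  have QE y z : Q (y ⊗ z) = (q y * q' z : k^o).
    by rewrite /Q tsumE //; multilin.
  have := congr1 Q (dd_fun2_comul_op_R h a a').
  rewrite !(linear_tsum (f := Q)) //.
  under eq_tsum => h1 h2.
    rewrite (linear_tsum (f := Q)) //.
    under eq_tsum => r1 r2 do rewrite QE mulrC.
    over.
  move=> ->; apply: eq_tsum => b1 b2; rewrite (linear_tsum (f := Q)) //.
  by apply: eq_tsum => y z; rewrite QE.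
under [RHS]eq_tsum => r1 r2.
  under eq_tsum => h1 h2.
    rewrite !dd_ident_sum mulr_tsumr.
    under eq_tsum => a q do rewrite mulr_tsuml.
    over.
  rewrite exchange_tsum; under eq_tsum => a q do rewrite exchange_tsum.
  over.
rewrite [RHS]exchange_tsum; apply: eq_tsum => a q.
rewrite [RHS]exchange_tsum; apply: eq_tsum => a' q'.
by rewrite exchange_tsum.
Qed.

Lemma dd_ident_iso : @algebra_iso k B (dual_R (dd_R A)) (dd_ident A).
Proof.
split; first exact: hom_lin.
- by exists dd_ident_inv; [exact: dd_identK | exact: dd_ident_invK].
- exact: dd_identM.
apply/lfunP => h; rewrite dd_ident_sum tsumE; last by multilin.
by rewrite /= dd_counitE.
Qed.

End Identification.

(** * Regular actions on the twisted dual *)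

Section DualActions.
Variables (k : fieldType) (H : bialgData k).
Hypothesis bialg_H : is_bialgebra H.
Implicit Types (x y h : H) (f g : dual H) (s t : H ⊗ H).

Let alg_H : is_algebra H. Proof. by case: bialg_H. Qed.
Let lin_D : linear (@bcomul k H). Proof. by case: bialg_H => _ []. Qed.
Let comulM x y : bcomul (amul x y) = tmul (bcomul x) (bcomul y).
Proof. by case: bialg_H => _ _ []. Qed.

Let mul_bil := amul_bilinear alg_H.
Let tmul_bil := tmul_bilinear alg_H.
Let lin_D_comp (X : vectType k) (g : X -> H) :
  linear g -> linear (fun z => bcomul (g z)).
Proof. exact: lin_comp. Qed.
Ltac multilin_fact ::=
  first [ apply: (lin_op_l mul_bil) | apply: (lin_op_r mul_bil)
        | apply: (lin_op_l tmul_bil) | apply: (lin_op_r tmul_bil)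
        | apply: lin_D_comp ].

Definition flip t : H ⊗ H := \sw_(x, y <- t) y ⊗ x.

Lemma flip_linear : linear flip.
Proof. by rewrite /flip; multilin. Qed.

Lemma flipE x y : flip (x ⊗ y) = y ⊗ x.
Proof. by rewrite /flip tsumE. Qed.

Lemma flipK t : flip (flip t) = t.
Proof.
rewrite {2}/flip (linear_tsum _ _ flip_linear).
by under eq_tsum => x y do rewrite flipE; rewrite tsum_id.
Qed.

Lemma flip_tmul s t : flip (tmul s t) = tmul (flip s) (flip t).
Proof.
rewrite {1}/flip sw_tmul // [RHS]/tmul tsum_tsum //; apply: eq_tsum => x y.
rewrite tsumE //.
by rewrite tsum_tsum //; apply: eq_tsum => x' y'; rewrite tsumE.
Qed.

Definition pairing f g t : k^o := \sw_(x, y <- t) (f x * g y : k^o).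

Lemma pairing_linear f g : linear (pairing f g).
Proof. by rewrite /pairing; multilin. Qed.

Lemma pairingE f g x y : pairing f g (x ⊗ y) = (f x * g y : k^o).
Proof. by rewrite /pairing tsumE //. Qed.

Lemma pairing_flip f g t : pairing f g (flip t) = pairing g f t.
Proof.
rewrite /flip (linear_tsum _ _ (pairing_linear f g)).
by apply: eq_tsum => x y; rewrite pairingE mulrC.
Qed.

Lemma pairing_lreg f g x y t :
  pairing (lreg x f) (lreg y g) t = pairing f g (tmul t (x ⊗ y)).
Proof.
rewrite /tmul (linear_tsum _ _ (pairing_linear f g)); apply: eq_tsum => u v.
by rewrite tsumE // pairingE !(lregE alg_H).
Qed.

Lemma pairing_rreg f g x y t :
  pairing (rreg f x) (rreg g y) t = pairing f g (tmul (x ⊗ y) t).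
Proof.
rewrite /tmul tsumE //.
rewrite (linear_tsum _ _ (pairing_linear f g)); apply: eq_tsum => u v.
by rewrite pairingE !(rregE alg_H).
Qed.

(** The product of the twisted dual is a pairing with Δ(h) R21.  As
    [pairing_lreg] and [pairing_rreg] turn the regular actions into
    multiplications of H ⊗ H, the compatibilities below become identities in the
    algebra H ⊗ H. *)
Lemma dual_R_pairing R f g h :
  amul (f : dual_R R) (g : dual_R R) h = pairing g f (tmul (bcomul h) (flip R)).
Proof.
rewrite (dual_R_mulE bialg_H) exchange_tsum /tmul.
rewrite (linear_tsum _ _ (pairing_linear g f)); apply: eq_tsum => h1 h2.
rewrite tsum_tsum // (linear_tsum _ _ (pairing_linear g f)).
by apply: eq_tsum => r1 r2; rewrite tsumE // pairingE.
Qed.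

Lemma lreg_bilinear : bilinear (@lreg k H).
Proof.
split=> [h|f] c x y; apply/lfunP => z;
  rewrite add_lfunE scale_lfunE !(lregE alg_H) //.
by rewrite add_lfunE scale_lfunE.
have lin_z : linear (fun x => f (amul z x)) by multilin.
exact: lin_z.
Qed.

Lemma rreg_bilinear : bilinear (@rreg k H).
Proof.
split=> [f|h] c x y; apply/lfunP => z;
  rewrite add_lfunE scale_lfunE !(rregE alg_H) //.
have lin_z : linear (fun x => f (amul x z)) by multilin.
exact: lin_z.
by rewrite add_lfunE scale_lfunE.
Qed.

Lemma lreg_lmodule : @is_lmodule k H (dual H) (@lreg k H).
Proof.
split=> [|f|h h' f]; first exact: lreg_bilinear.
  by apply/lfunP => x; rewrite lregE // amulr1.
by apply/lfunP => x; rewrite !(lregE alg_H) amulA.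
Qed.

Lemma rreg_rmodule : @is_rmodule k H (dual H) (@rreg k H).
Proof.
split=> [|f|h h' f]; first exact: rreg_bilinear.
  by apply/lfunP => x; rewrite rregE // amul1.
by apply/lfunP => x; rewrite !(rregE alg_H) amulA.
Qed.

Lemma lreg_rreg h f h' : rreg (lreg h f) h' = lreg h (rreg f h').
Proof.
by apply/lfunP => x; rewrite (rregE alg_H) !(lregE alg_H) (rregE alg_H) amulA.
Qed.

Lemma lreg_counit h : lreg h (bcounit H) = (bcounit H h : k) *: bcounit H.
Proof.
apply/lfunP => x; rewrite (lregE alg_H) scale_lfunE.
by case: bialg_H => _ _ _ [-> _]; apply: mulrC.
Qed.

Lemma rreg_counit h : rreg (bcounit H) h = (bcounit H h : k) *: bcounit H.
Proof.
apply/lfunP => x; rewrite (rregE alg_H) scale_lfunE.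
by case: bialg_H => _ _ _ [-> _].
Qed.

Section RMatrix.
Variable R : H ⊗ H.
Hypothesis R_comul : forall h, tmul R (bcomul h) = tmul (flip (bcomul h)) R.

Lemma flip_R_comul h :
  tmul (bcomul h) (flip R) = tmul (flip R) (flip (bcomul h)).
Proof. by rewrite -flip_tmul R_comul flip_tmul flipK. Qed.

(** At x, this is Δ(x) R21 Δ^op(h) = Δ(x) Δ(h) R21. *)
Lemma lreg_dual_R h (f g : dual_R R) :
  \sw_(h1, h2 <- bcomul h) amul (lreg h1 f : dual_R R) (lreg h2 g : dual_R R)
  = lreg h (amul f g).
Proof.
apply/lfunP => x; rewrite (lregE alg_H) dual_R_pairing comulM -(tmulA alg_H).
rewrite flip_R_comul (tmulA alg_H) sum_lfunE.
transitivity (\sw_(h1, h2 <- bcomul h)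
   pairing g f (tmul (tmul (bcomul x) (flip R)) (h2 ⊗ h1))).
  by apply: eq_bigr => i _; rewrite dual_R_pairing pairing_lreg.
rewrite -(linear_tsum _ _ (pairing_linear g f)).
by rewrite -(linear_tsum _ _ (proj1 tmul_bil _)).
Qed.

(** At x, this is Δ(h) (Δ(x) R21) = Δ(h x) R21. *)
Lemma rreg_dual_R h (f g : dual_R R) :
  \sw_(h1, h2 <- bcomul h) amul (rreg f h2 : dual_R R) (rreg g h1 : dual_R R)
  = rreg (amul f g) h.
Proof.
apply/lfunP => x; rewrite (rregE alg_H) dual_R_pairing comulM sum_lfunE.
transitivity (\sw_(h1, h2 <- bcomul h)
   pairing g f (tmul (h1 ⊗ h2) (tmul (bcomul x) (flip R)))).
  by apply: eq_bigr => i _; rewrite dual_R_pairing pairing_rreg.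
rewrite -(linear_tsum _ _ (pairing_linear g f)).
by rewrite -(linear_tsum (f := fun t => tmul t _)) // tsum_id (tmulA alg_H).
Qed.

(** At x, this is U21 Δ(x) R21 R = U21 R21 Δ^op(x) R = Δ^op(x) R, which is
    Δ(x) R21 with its factors exchanged. *)
Lemma braided_dual_R U (f g : dual_R R) : tens_inverse R U ->
  \sw_(r1, r2 <- R) \sw_(u1, u2 <- U)
    amul (rreg (lreg r2 g) u1 : dual_R R) (rreg (lreg r1 f) u2 : dual_R R)
  = amul f g.
Proof.
case=> _ UR; apply/lfunP => x; rewrite dual_R_pairing -pairing_flip.
rewrite flip_tmul flipK; have -> : flip (bcomul x) =
    tmul (flip U) (tmul (bcomul x) (flip R)).
  by rewrite flip_R_comul (tmulA alg_H) -flip_tmul UR flipE (tmul1 alg_H).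
rewrite sum_lfunE -[X in tmul _ X]tsum_id.
rewrite (linear_tsum (f := tmul _)) // (linear_tsum _ _ (pairing_linear f g)).
apply: eq_bigr => i _; move: (vbas i) (R (dbas i)) => r1 r2.
rewrite sum_lfunE {1}/flip -(tmulA alg_H).
rewrite (linear_tsum (f := fun t => tmul t _)) //.
rewrite (linear_tsum _ _ (pairing_linear f g)).
apply: eq_bigr => j _; move: (vbas j) (U (dbas j)) => u1 u2.
by rewrite dual_R_pairing pairing_rreg pairing_lreg -(tmulA alg_H).
Qed.

End RMatrix.
End DualActions.

(** * Transport of the actions to the Heisenberg double *)

(** The regular actions of H on its twisted dual, carried to B along an algebra
    isomorphism f with inverse f'. *)
Section TransportedActions.
Variables (k : fieldType) (H : bialgData k) (R : H ⊗ H) (B : algData k).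
Hypotheses (bialg_H : is_bialgebra H) (alg_B : is_algebra B).
Hypothesis R_comul :
  forall h, tmul R (bcomul h) = tmul (flip (bcomul h)) R.
Variables (f : 'Hom(B, dual H)) (f' : 'Hom(dual H, B)).
Hypotheses (fK : cancel f f') (f'K : cancel f' f).
Hypothesis fM : forall x y,
  f (amul x y) = amul (f x : dual_R R) (f y : dual_R R).
Hypothesis f1 : f (aone B) = bcounit H.
Implicit Types (x y b c : B) (h : H).

Let la h b : B := f' (lreg h (f b)).
Let ra b h : B := f' (rreg (f b) h).

Let lin_D : linear (@bcomul k H). Proof. by case: bialg_H => _ []. Qed.
Let mul_bil := amul_bilinear alg_B.
Let lreg_bil := lreg_bilinear bialg_H.
Let rreg_bil := rreg_bilinear bialg_H.
Let la_bil : bilinear la.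
Proof.
split=> [h|b].
  apply: lin_comp (@hom_lin _ _ _ f') _.
  exact: (lin_op_r lreg_bil (@hom_lin _ _ _ f)).
apply: lin_comp (@hom_lin _ _ _ f') _.
exact: (lin_op_l lreg_bil (@lin_id _ _)).
Qed.
Let ra_bil : bilinear ra.
Proof.
split=> [b|h].
  apply: lin_comp (@hom_lin _ _ _ f') _.
  exact: (lin_op_r rreg_bil (@lin_id _ _)).
apply: lin_comp (@hom_lin _ _ _ f') _.
exact: (lin_op_l rreg_bil (@hom_lin _ _ _ f)).
Qed.

Ltac multilin_fact ::=
  first [ apply: (lin_op_l mul_bil) | apply: (lin_op_r mul_bil)
        | apply: (lin_op_l la_bil) | apply: (lin_op_r la_bil)
        | apply: (lin_op_l ra_bil) | apply: (lin_op_r ra_bil) ].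

Let f_inj : injective f. Proof. exact: can_inj fK. Qed.
Let f_la h b : f (la h b) = lreg h (f b). Proof. exact: f'K. Qed.
Let f_ra b h : f (ra b h) = rreg (f b) h. Proof. exact: f'K. Qed.

Let sw_la h x y :
  \sw_(h1, h2 <- bcomul h) amul (la h1 x) (la h2 y) = la h (amul x y).
Proof.
apply: f_inj; rewrite hom_tsum f_la fM -(lreg_dual_R bialg_H R_comul).
by apply: eq_tsum => h1 h2; rewrite fM !f_la.
Qed.

Let sw_ra h x y :
  \sw_(h1, h2 <- bcomul h) amul (ra x h2) (ra y h1) = ra (amul x y) h.
Proof.
apply: f_inj; rewrite hom_tsum f_ra fM -(rreg_dual_R bialg_H).
by apply: eq_tsum => h1 h2; rewrite fM !f_ra.
Qed.

Let lmodule_la : @is_lmodule k H B la.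
Proof.
case: (lreg_lmodule bialg_H) => _ la1 laM.
split=> [|b|h h' b]; first exact: la_bil; apply: f_inj; rewrite !f_la //.
Qed.

Let rmodule_ra : @is_rmodule k H B ra.
Proof.
case: (rreg_rmodule bialg_H) => _ ra1 raM.
split=> [|b|h h' b]; first exact: ra_bil; apply: f_inj; rewrite !f_ra //.
Qed.

Let ra_la h b h' : ra (la h b) h' = la h (ra b h').
Proof. by apply: f_inj; rewrite !(f_la, f_ra) lreg_rreg. Qed.

Let la1 h : la h (aone B) = (bcounit H h : k) *: aone B.
Proof. by apply: f_inj; rewrite f_la homZ f1 lreg_counit. Qed.

Let ra1 h : ra (aone B) h = (bcounit H h : k) *: aone B.
Proof. by apply: f_inj; rewrite f_ra homZ f1 rreg_counit. Qed.

Let tmult_linear : linear (@tmult k B).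
Proof. by rewrite /tmult; multilin. Qed.

Let tmultE x y : tmult (x ⊗ y) = amul x y.
Proof. by rewrite /tmult tsumE. Qed.

Lemma transported_algebra_in_l : algebra_in_l la.
Proof.
split=> // h t; rewrite /ltens !(linear_tsum _ _ tmult_linear).
rewrite [in RHS]/tmult (linear_tsum (f := la h)) //.
under eq_tsum => h1 h2 do rewrite (linear_tsum _ _ tmult_linear).
rewrite exchange_tsum; apply: eq_tsum => x y; rewrite -sw_la.
by apply: eq_tsum => h1 h2; rewrite tmultE.
Qed.

Lemma transported_algebra_in_r : algebra_in_r ra.
Proof.
split=> // t h; rewrite /rtens !(linear_tsum _ _ tmult_linear).
rewrite [in RHS]/tmult (linear_tsum (f := fun b => ra b h)) //.
under eq_tsum => h1 h2 do rewrite (linear_tsum _ _ tmult_linear).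
rewrite exchange_tsum; apply: eq_tsum => x y; rewrite -sw_ra.
by apply: eq_tsum => h1 h2; rewrite tmultE.
Qed.

Lemma transported_algebra_in_lr : algebra_in_lr la ra.
Proof.
split=> // [h t h'|h h']; last first.
  by rewrite la1 (linear_scale (f := fun b => ra b h')) // ra1 scalerA.
rewrite /lrtens !(linear_tsum _ _ tmult_linear).
rewrite [in RHS]/tmult (linear_tsum (f := fun b => ra (la h b) h')) //.
under [RHS]eq_tsum => x y.
  rewrite -sw_la (linear_tsum (f := fun b => ra b h')) //.
  under eq_tsum => h1 h2 do rewrite -sw_ra.
  over.
rewrite [RHS]exchange_tsum; apply: eq_tsum => h1 h2.
rewrite (linear_tsum _ _ tmult_linear) [RHS]exchange_tsum.
apply: eq_tsum => h1' h2'; rewrite (linear_tsum _ _ tmult_linear).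
by apply: eq_tsum => x y; rewrite tmultE.
Qed.

Lemma transported_quantum_commutative U :
  tens_inverse R U -> quantum_commutative_lr R U la ra.
Proof.
move=> invU t; rewrite /= /braiding_lr (linear_tsum _ _ tmult_linear).
apply: eq_tsum => x y; apply: f_inj.
rewrite fM -(braided_dual_R bialg_H R_comul _ _ invU).
rewrite (linear_tsum _ _ tmult_linear) hom_tsum; apply: eq_tsum => r1 r2.
rewrite (linear_tsum _ _ tmult_linear) hom_tsum; apply: eq_tsum => u1 u2.
by rewrite tmultE fM !(f_la, f_ra).
Qed.

End TransportedActions.

Theorem proposition4p1 (k : fieldType) (A : hopfAlgType k) :
  let H := drinfeld_double A in
  let R := dd_R A in
  let B := heisenberg_double A in
  is_quasitriangular R /\
  @algebra_iso k B (dual_R R) (dd_ident A) /\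
  @algebra_in_l k H B (@heis_lact k A) /\
  @algebra_in_r k H B (@heis_ract k A) /\
  @algebra_in_lr k H B (@heis_lact k A) (@heis_ract k A) /\
  exists U : tensor H H, tens_inverse R U /\
    @quantum_commutative_lr k H R U B (@heis_lact k A) (@heis_ract k A).
Proof.
move=> H R B.
have ker0 : lker (dd_ident A) == 0%VS.
  by apply/lker0P; apply: can_inj (@dd_identK k A).
have fK := lker0_lfunK ker0.
have f'K : cancel (dd_ident A)^-1%VF (dd_ident A).
  move=> phi; rewrite -{1}(dd_ident_invK phi) fK; exact: dd_ident_invK.
have [_ _ fM f1] := dd_ident_iso A.
have bialg := dd_is_bialgebra A; have alg := heis_is_algebra A.
split; first exact: dd_is_quasitriangular.
split; first exact: dd_ident_iso.
have RD := @dd_R_comul k A.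
split; first exact: (transported_algebra_in_l bialg alg RD fK f'K fM f1).
split; first exact: (transported_algebra_in_r bialg alg fK f'K fM f1).
split; first exact: (transported_algebra_in_lr bialg alg RD fK f'K fM f1).
exists (dd_Rinv A); split; first exact: dd_R_inverse.
exact: (transported_quantum_commutative bialg alg RD fK f'K fM
  (dd_R_inverse A)).
Qed.
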